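(* Let $p\ge 5$ be a prime. For any $p$-adic integer $\alpha$ with $0\le \langle \alpha \rangle_p\le \lfloor p/4 \rfloor$, we have \[ \sum_{k=0}^{\frac{p-1}{2}} \frac{\left(\frac12\right)_k^3\left(\frac14\right)_k\left(\frac76\right)_k\left(\frac12+\alpha\right)_k\left(\frac14-\alpha\right)_k}{(1)_k^3\left(\frac16\right)_k(1+2\alpha)_k\left(\frac12-2\alpha\right)_k\, k!} \equiv \begin{cases} (-1)^{\frac{p+3}{4}}p\,\Gamma_p\!\left(\tfrac{1}{2}\right)\Gamma_p\!\left(\tfrac{1}{4}\right)^2 \Gamma_p(1+\alpha)\Gamma_p\!\left(\tfrac{3}{4}-\alpha\right)\Gamma_p\!\left(\tfrac{1}{2}+\alpha\right)^3\Gamma_p\!\left(\tfrac{1}{4}-\alpha\right)^3 \pmod{p^3} & \text{if } p\equiv 1\pmod 4,\\[4pt] 0 \pmod{p^3} & \text{if } p\equiv 3\pmod 4. \end{cases} \]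
   Context: $(x)_k=x(x+1)\cdots(x+k-1)$ denotes the rising factorial, with $(x)_0=1$. For a $p$-adic integer $x$, $\langle x\rangle_p$ denotes the least non-negative integer $r$ with $x\equiv r\pmod p$, and $\lfloor x\rfloor$ is the floor function. $\Gamma_p$ is Morita's $p$-adic Gamma function: for $x\in\mathbb{Z}_p$, $\Gamma_p(x)=\lim_{m\to x}(-1)^m\prod_{0\le k<m,\ (k,p)=1}k$, the limit taken over non-negative integers $m$ tending to $x$ $p$-adically. Congruences are in $\mathbb{Z}_p$. *)

(* Defs.v *)
(* p-adic integers are modelled as coherent sequences of
   integer approximations (the inverse limit Z_p = lim Z/p^n Z). *)
From HB Require Import structures.
From mathcomp Require Import all_boot all_order all_algebra.
From Stdlib Require Import ClassicalEpsilon.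
Set Implicit Arguments. Unset Strict Implicit. Unset Printing Implicit Defensive.
Import Order.TTheory GRing.Theory Num.Theory.
Local Open Scope ring_scope.

(* x : nat -> int represents the p-adic integer lim x n, with x n determined mod p^n *)
Definition padic_seq (p : nat) (x : nat -> int) : Prop :=
  forall n : nat, (x n.+1 == x n %[mod (p ^ n)%:Z])%Z.

Definition pcong (p k : nat) (x y : nat -> int) : Prop :=
  (x k == y k %[mod (p ^ k)%:Z])%Z.

Definition inv_mod (a m : int) : int := (egcdz a m).1.

Definition ratZp (p : nat) (r : rat) : nat -> int :=
  fun n => numq r * inv_mod (denq r) (p ^ n)%:Z.

Definition rfr (x : rat) (k : nat) : rat := \prod_(j < k) (x + j%:R).
Definition rfz (x : int) (k : nat) : int := \prod_(j < k) (x + j%:R).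

Definition gam_nat (p m : nat) : int :=
  (-1) ^+ m * \prod_(0 <= k < m | ~~ (p %| k)%N) (k%:Z).

(* Morita's p-adic Gamma function: the p-adic limit of gam_nat p m as the
   non-negative integer m tends p-adically to x *)
Definition Gammap (p : nat) (x : nat -> int) : nat -> int :=
  epsilon (inhabits (fun _ : nat => 0 : int))
    (fun g => forall n : nat, exists N : nat, forall m : nat,
       (m%:Z == x N %[mod (p ^ N)%:Z])%Z ->
       (gam_nat p m == g n %[mod (p ^ n)%:Z])%Z).

Definition coef (k : nat) : rat :=
  rfr (1 / 2) k ^+ 3 * rfr (1 / 4) k * rfr (7 / 6) k
  / (rfr 1 k ^+ 3 * rfr (1 / 6) k * (k`!)%:R).

Definition lhs (p : nat) (a : nat -> int) : nat -> int :=
  fun n => \sum_(k < (p - 1)./2.+1)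
    ratZp p (coef k) n
    * rfz (ratZp p (1 / 2) n + a n) k * rfz (ratZp p (1 / 4) n - a n) k
    * inv_mod (rfz (1 + 2 * a n) k * rfz (ratZp p (1 / 2) n - 2 * a n) k)
              (p ^ n)%:Z.

(* Main.v *)
(* The summand is c_k prod_{j<k} 4((2j+1)^2 - w) / (16(j+1)^2 - w) at w = 0, where
   c_k depends on k and alpha only, not on w.
   At w = (2N+1)^2 the sum terminates at k = N, and the WZ method evaluates it:
   it satisfies a first-order recurrence N -> N+2, vanishes for N odd, and is an
   explicit product containing the factor 2N+1 for N even.  Let M = (p-1)/2.
   Clearing denominators gives a polynomial P in w of degree at most M, and the
   evaluations show that p divides P((2N+1)^2) for N = 0, ..., M.  These points are
   distinct mod p, so p divides every coefficient of P and P(0) = P(p^2) mod p^3.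
   The point w = p^2 is N = M, where the sum is 0 if p = 3 mod 4 and p times a
   quotient of Pochhammer symbols if p = 1 mod 4.  That quotient is needed mod p^2
   only, where the functional equation of Gamma_p gives reflection and
   Gamma_p(x+pT) Gamma_p(x-pT) = Gamma_p(x)^2. *)
Require Import Defs.
From HB Require Import structures.
From mathcomp Require Import all_boot all_order all_algebra.
From mathcomp Require Import ring lra zify.
From Stdlib Require Import ClassicalEpsilon.
Set Implicit Arguments. Unset Strict Implicit. Unset Printing Implicit Defensive.
Import Order.TTheory GRing.Theory Num.Theory.
Local Open Scope ring_scope.

(** * WZ recurrence *)

(** Here [d] stands for alpha and [y] for w. At [y] = 0 this is the ratio of consecutive terms of
    the original series, apart from the factor 6k + 1 = (7/6)_k / (1/6)_k. *)
Definition term_ratio (d y : rat) (j : nat) : rat :=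
  (2 * j%:R + 1) * (4 * j%:R + 1) * (2 * d + 1 + 2 * j%:R)
    * (4 * j%:R + 1 - 4 * d) * ((2 * j%:R + 1) ^+ 2 - y)
  / (8 * (j%:R + 1) ^+ 2 * (2 * j%:R + 1 - 4 * d) * (2 * d + 1 + j%:R)
    * (16 * (j%:R + 1) ^+ 2 - y)).

Definition hyper_sum (d y : rat) (n : nat) : rat :=
  \sum_(k < n) (6 * k%:R + 1) * \prod_(j < k) term_ratio d y j.

(** A hybrid of the ratios at N and N + 2: of the parts depending on N, one factor of the numerator
    and one of the denominator comes from each. Both products then differ from this one by a
    rational function of n. *)
Definition wz_ratio (d N : rat) (j : nat) : rat :=
  (2 * j%:R + 1) * (4 * j%:R + 1) * (2 * d + 1 + 2 * j%:R)
    * (4 * j%:R + 1 - 4 * d) * (4 * (j%:R - N - 2) * (j%:R + N + 1))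
  / (8 * (j%:R + 1) ^+ 2 * (2 * j%:R + 1 - 4 * d) * (2 * d + 1 + j%:R)
    * ((4 * j%:R - 1 - 2 * N) * (4 * j%:R + 5 + 2 * N))).

Ltac split_neq0 :=
  repeat (apply/andP; split); try done;
  match goal with
  | h : is_true (_ != 0) |- is_true (_ != 0) =>
      solve [exact: h | apply: contraNneq h => ?; apply/eqP; lra]
  end.

Section WZ.
Variables d N : rat.
Hypothesis hN1 : N + 1 != 0.
Hypothesis hN2 : N + 2 != 0.
Hypothesis hd1 : forall j : nat, 2 * j%:R + 1 - 4 * d != 0.
Hypothesis hd2 : forall j : nat, 2 * d + 1 + j%:R != 0.
Hypothesis hN3 : forall j : nat, 4 * j%:R - 1 - 2 * N != 0.
Hypothesis hN4 : forall j : nat, 4 * j%:R + 5 + 2 * N != 0.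

(** The quotient of [term_ratio] by [wz_ratio] at j is (j-N)/(j-N-2) times (4j-1-2N)/(4j+3-2N); both
    factors telescope. *)
Lemma prod_term_ratio n : \prod_(j < n) term_ratio d ((2 * N + 1) ^+ 2) j =
  \prod_(j < n) wz_ratio d N j * ((n%:R - N - 1) * (n%:R - N - 2) * (1 + 2 * N))
   / ((N + 1) * (N + 2) * (2 * N + 1 - 4 * n%:R)).
Proof.
elim: n => [|n IH].
  by have := hN3 0; rewrite !big_ord0 => h; field; split_neq0.
rewrite !big_ord_recr /= IH /term_ratio /wz_ratio.
have h1 := hN3 n; have h2 := hN3 n.+1; have h3 := hN4 n.
have h4 := hd1 n; have h5 := hd2 n.
rewrite -natr1 in h2 *.
have h6 : (n%:R + 1 : rat) != 0 by rewrite natr1 pnatr_eq0.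
have -> : (2 * n%:R + 1) ^+ 2 - (2 * N + 1) ^+ 2 = 4 * (n%:R - N) * (n%:R + N + 1) :> rat by ring.
have -> : 16 * (n%:R + 1) ^+ 2 - (2 * N + 1) ^+ 2 = (4 * n%:R + 3 - 2 * N) * (4 * n%:R + 5 + 2 * N) :> rat by ring.
by field; split_neq0.
Qed.

(** Now the quotient is (j+N+3)/(j+N+1) times (4j+5+2N)/(4j+9+2N), which telescopes too. *)
Lemma prod_term_ratio2 n : \prod_(j < n) term_ratio d ((2 * (N + 2) + 1) ^+ 2) j =
  \prod_(j < n) wz_ratio d N j * ((n%:R + N + 1) * (n%:R + N + 2) * (5 + 2 * N))
   / ((N + 1) * (N + 2) * (4 * n%:R + 5 + 2 * N)).
Proof.
elim: n => [|n IH].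
  by have := hN4 0; rewrite !big_ord0 => h; field; split_neq0.
rewrite !big_ord_recr /= IH /term_ratio /wz_ratio.
have h1 := hN3 n; have h2 := hN4 n.+1; have h3 := hN4 n.
have h4 := hd1 n; have h5 := hd2 n.
rewrite -natr1 in h2 *.
have h6 : (n%:R + 1 : rat) != 0 by rewrite natr1 pnatr_eq0.
have -> : (2 * n%:R + 1) ^+ 2 - (2 * (N + 2) + 1) ^+ 2 =
  4 * (n%:R - N - 2) * (n%:R + N + 3) :> rat by ring.
have -> : 16 * (n%:R + 1) ^+ 2 - (2 * (N + 2) + 1) ^+ 2 =
  (4 * n%:R - 1 - 2 * N) * (4 * n%:R + 9 + 2 * N) :> rat by ring.
by field; split_neq0.
Qed.

(** The right side is the WZ certificate: its increment in n equals the combination of the n-th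
    terms, a rational function identity once both products are written through [wz_ratio]. The
    factor n^2 makes it vanish at n = 0. *)
Lemma wz_telescope n :
  (N + 2) * (N + 2 + 2 * d) * (2 * N + 3 - 4 * d) * (2 * N + 1)
    * hyper_sum d ((2 * (N + 2) + 1) ^+ 2) n
  - (N + 1) * (N + 1 - 2 * d) * (2 * N + 3 + 4 * d) * (2 * N + 5)
    * hyper_sum d ((2 * N + 1) ^+ 2) n
  = - 2 * (2 * N + 1) * (2 * N + 3) * (2 * N + 5) * n%:R ^+ 2 * (2 * d + n%:R)
    * (2 * n%:R - 1 - 4 * d) / ((N + 1) * (N + 2)) * \prod_(j < n) wz_ratio d N j.
Proof.
elim: n => [|n IH].
  by rewrite /hyper_sum !big_ord0; ring.
have hyper_sumS y : hyper_sum d y n.+1 = hyper_sum d y n + (6 * n%:R + 1) * \prod_(j < n) term_ratio d y j.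
  by rewrite /hyper_sum big_ord_recr.
have splitE (a b s1 s2 x y : rat) :
  a * (s1 + x) - b * (s2 + y) = (a * s1 - b * s2) + (a * x - b * y) by ring.
rewrite !hyper_sumS splitE IH prod_term_ratio prod_term_ratio2 big_ord_recr /=.
set P := \prod_(j < n) _.
rewrite /wz_ratio.
have h1 := hN3 n; have h3 := hN4 n.
have h4 := hd1 n; have h5 := hd2 n.
rewrite -natr1.
have h6 : (n%:R + 1 : rat) != 0 by rewrite natr1 pnatr_eq0.
by field; split_neq0.
Qed.
End WZ.

(** At natural alpha and N the denominators of the WZ identity are positive or odd integers; this
    settles the odd ones. *)
Lemma odd_neq0 (z : int) : 2 * z%:~R + 1 != 0 :> rat.
Proof.
have -> : 2 * z%:~R + 1 = (2 * z + 1)%:~R :> rat by rewrite rmorphD rmorphM.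
by rewrite intr_eq0; lia.
Qed.

Lemma eq_neq0 {x y : rat} : y != 0 -> x = y -> x != 0.
Proof. by move=> h ->. Qed.

Lemma term_ratio_eq0 d (N : nat) : term_ratio d ((2 * N%:R + 1) ^+ 2) N = 0.
Proof. by rewrite /term_ratio subrr !(mulr0, mul0r). Qed.

(** The ratio at j = N contains (2N+1)^2 - w = 0, so all terms with k > N vanish. *)
Lemma hyper_sum_stable d (N n : nat) : (N < n)%N ->
  hyper_sum d ((2 * N%:R + 1) ^+ 2) n = hyper_sum d ((2 * N%:R + 1) ^+ 2) N.+1.
Proof.
elim: n => // n IH; rewrite ltnS leq_eqVlt => /orP[/eqP->//|lt].
rewrite -IH // {1}/hyper_sum big_ord_recr /=.
by rewrite [\prod_(j < n) _](bigD1 (Ordinal lt)) //= term_ratio_eq0 mul0r mulr0 addr0.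
Qed.

(** * Evaluation of the terminating sums at natural alpha and N *)

Section NatParameters.
Variables (A N : nat).

(** For n > N + 2 the certificate contains the zero factor [wz_ratio] at j = N + 2, so telescoping
    leaves a homogeneous recurrence from N to N + 2. *)
Lemma hyper_sum_step n : (N.+2 < n)%N ->
  (N%:R + 2) * (N%:R + 2 + 2 * A%:R) * (2 * N%:R + 3 - 4 * A%:R) * (2 * N%:R + 1)
    * hyper_sum A%:R ((2 * N.+2%:R + 1) ^+ 2) n
  = (N%:R + 1) * (N%:R + 1 - 2 * A%:R) * (2 * N%:R + 3 + 4 * A%:R) * (2 * N%:R + 5)
    * hyper_sum A%:R ((2 * N%:R + 1) ^+ 2) n.
Proof.
move=> lt; apply/eqP; rewrite -subr_eq0; apply/eqP.
have -> : N.+2%:R = N%:R + 2 :> rat by rewrite -addn2 natrD.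
rewrite wz_telescope.
- have w0 : wz_ratio A%:R N%:R N.+2 = 0.
    rewrite /wz_ratio; have -> : N.+2%:R = N%:R + 2 :> rat by rewrite -addn2 natrD.
    by have -> : N%:R + 2 - N%:R - 2 = 0 :> rat by [ring]; rewrite !(mulr0, mul0r).
  by rewrite (bigD1 (Ordinal lt)) //= w0 mul0r mulr0.
- by rewrite natr1 pnatr_eq0.
- by rewrite -natrD pnatr_eq0 addn2.
- move=> j. by apply: (eq_neq0 (odd_neq0 (j%:Z - 2 * A%:Z))); ring.
- move=> j; by apply: (@eq_neq0 _ (2 * A + j).+1%:R); [by rewrite pnatr_eq0|ring].
- move=> j; by apply: (eq_neq0 (odd_neq0 (2 * j%:Z - 1 - N%:Z))); ring.
- move=> j; by apply: (eq_neq0 (odd_neq0 (2 * j%:Z + 2 + N%:Z))); ring.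
Qed.
End NatParameters.

(** At N = 1 the sum is 1 + 7(-1/7) = 0, and the recurrence carries the zero along the odd N. *)
Lemma hyper_sum_odd (A s n : nat) : (s.*2.+1 < n)%N ->
  hyper_sum A%:R ((2 * s.*2.+1%:R + 1) ^+ 2) n = 0.
Proof.
elim: s n => [|s IH] n lt.
  rewrite double0 in lt *.
  rewrite (hyper_sum_stable A%:R lt) /hyper_sum !(big_ord_recr, big_ord0) /= /term_ratio.
  have h1 : 1 - 4 * A%:R != 0 :> rat.
    by apply: (eq_neq0 (odd_neq0 (- (2 * A%:Z)))); ring.
  have h2 : 2 * A%:R + 1 != 0 :> rat.
    by apply: (eq_neq0 (odd_neq0 (A%:Z))); ring.
  by field; split_neq0.
have lt3 : (s.*2.+1.+2 < n)%N by [].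
have := hyper_sum_step A lt3.
rewrite IH ?mulr0; last by lia.
move/eqP; rewrite mulf_eq0 => /orP[|/eqP //].
(* The leading coefficient is nonzero: two of its factors are positive and two are odd. *)
rewrite !mulf_eq0 => /orP[/orP[/orP[|]|]|]; apply: contraTeq => _.
- by rewrite -natrD pnatr_eq0.
- by apply: (@eq_neq0 _ (s.*2.+3 + 2 * A)%:R); [by rewrite pnatr_eq0|ring].
- by apply: (eq_neq0 (odd_neq0 (s.*2.+1%:Z + 1 - 2 * A%:Z))); ring.
- by apply: (eq_neq0 (odd_neq0 (s.*2.+1%:Z))); ring.
Qed.

(** The recurrence is solved from the value 1 at N = 0. Its factors (2N+5)/(2N+1) telescope to 4s +
    1 = 2N + 1, which supplies the factor p at N = (p-1)/2. *)
Lemma hyper_sum_even (A s n : nat) : (s.*2 < n)%N ->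
  hyper_sum A%:R ((2 * s.*2%:R + 1) ^+ 2) n =
  (4 * s%:R + 1) * \prod_(j < s)
    ((4 * j%:R + 2) * (4 * j%:R + 2 - 4 * A%:R) * (4 * j%:R + 3 + 4 * A%:R)
     / ((4 * j%:R + 4) * (4 * j%:R + 4 + 4 * A%:R) * (4 * j%:R + 3 - 4 * A%:R))).
Proof.
elim: s n => [|s IH] n lt.
  rewrite double0 in lt *.
  by rewrite (hyper_sum_stable A%:R lt) /hyper_sum !(big_ord_recr, big_ord0) /=; ring.
have lt3 : (s.*2.+2 < n)%N by [].
have := hyper_sum_step A lt3.
rewrite IH; last by lia.
rewrite big_ord_recr /=; set P := \prod_(j < s) _.
set T := hyper_sum _ _ _.
have h1 : 4 * s%:R + 3 - 4 * A%:R != 0 :> rat.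
  by apply: (eq_neq0 (odd_neq0 (2 * s%:Z + 1 - 2 * A%:Z))); ring.
have h2 : s%:R + 1 != 0 :> rat by rewrite natr1 pnatr_eq0.
have h3 : s%:R + 1 + A%:R != 0 :> rat.
  by apply: (@eq_neq0 _ (s.+1 + A)%:R); [by rewrite pnatr_eq0|ring].
have h4 : 4 * s%:R + 1 != 0 :> rat.
  by apply: (eq_neq0 (odd_neq0 (2 * s%:Z))); ring.
have -> : s.*2%:R = 2 * s%:R :> rat by rewrite -mul2n natrM.
rewrite -[s.+1%:R]natr1.
move=> E; apply: (@mulfI _ ((2 * s%:R + 2) * (2 * s%:R + 2 + 2 * A%:R) *
     (2 * (2 * s%:R) + 3 - 4 * A%:R) * (2 * (2 * s%:R) + 1))).
  have -> : (2 * s%:R + 2) * (2 * s%:R + 2 + 2 * A%:R) *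
     (2 * (2 * s%:R) + 3 - 4 * A%:R) * (2 * (2 * s%:R) + 1) =
     4 * (s%:R + 1) * (s%:R + 1 + A%:R) * (4 * s%:R + 3 - 4 * A%:R) * (4 * s%:R + 1)
     :> rat by ring.
  by rewrite !mulf_neq0.
by rewrite E; field; split_neq0.
Qed.

(** * Congruences and the p-adic Gamma function *)

Lemma intr_Zp_eq0 (q : nat) (x : int) : (1 < q)%N ->
  (x%:~R == 0 :> 'Z_q) = (q%:Z %| x)%Z.
Proof.
move=> q1.
have nat_case (n : nat) : (n%:R == 0 :> 'Z_q) = (q %| n)%N.
  by rewrite -(inj_eq val_inj) /= val_Zp_nat.
case: x => n; first by rewrite -pmulrn nat_case.
by rewrite NegzE rmorphN /= oppr_eq0 -pmulrn nat_case dvdzE abszN.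
Qed.

(** Congruences are moved into a ring, where units cancel and [ring] applies. The bound on [q]
    matters, as ['Z_q] is Z/2 for q < 2. *)
Lemma intr_Zp_eq (q : nat) (x y : int) : (1 < q)%N ->
  (x%:~R == y%:~R :> 'Z_q) = (x == y %[mod q%:Z])%Z.
Proof. by move=> q1; rewrite -subr_eq0 -rmorphB intr_Zp_eq0 // eqz_mod_dvd. Qed.

Lemma dvdz_abs_nat (p : nat) (x : int) : (p%:Z %| x)%Z = (p %| `|x|)%N.
Proof. by []. Qed.

Lemma intr_Zp_unit (p n : nat) (x : int) : prime p -> (0 < n)%N ->
  ~~ (p%:Z %| x)%Z -> (x%:~R : 'Z_(p ^ n)) \is a GRing.unit.
Proof.
move=> pp n0 px.
have q1 : (1 < p ^ n)%N by rewrite -(exp1n n) ltn_exp2r ?prime_gt1.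
have cop : coprime (p ^ n) `|x| by rewrite coprimeXl // prime_coprime.
have [u [v uv]] := Bezoutz x (p ^ n)%:Z.
have uvE : u * x + v * (p ^ n)%:Z = 1.
  by rewrite uv /gcdz /= gcdnC; move: cop => /eqP ->.
have E : (x%:~R * u%:~R : 'Z_(p ^ n)) = 1.
  apply/eqP; rewrite -rmorphM -[1]/(1%:~R) intr_Zp_eq // -uvE mulrC.
  by rewrite eqz_mod_dvd; apply/dvdzP; exists (- v); ring.
by apply/unitrP; exists u%:~R; rewrite mulrC.
Qed.

(** * Products over windows of consecutive integers, without the multiples of p *)

Section Blocks.
Variable p : nat.
Hypothesis pp : prime p.
Hypothesis p2 : (2 < p)%N.

(** The factor in the functional equation Gamma_p(x+1) = - [pfree] x Gamma_p(x), valid for multiples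
    of p as well. *)
Definition pfree (x : int) : int := if (p%:Z %| x)%Z then 1 else x.

Lemma pfree_ndvd x : ~~ (p%:Z %| pfree x)%Z.
Proof.
rewrite /pfree; case: ifPn => // _.
by rewrite dvdz_abs_nat dvdn1; apply: contraTneq pp => ->.
Qed.

Lemma pfreeD x y : (p%:Z %| y)%Z ->
  pfree (x + y) = if (p%:Z %| x)%Z then 1 else x + y.
Proof. by move=> py; rewrite /pfree rpredDr. Qed.

Lemma pfreeN x : pfree (- x) = if (p%:Z %| x)%Z then 1 else - x.
Proof. by rewrite /pfree rpredN. Qed.

Lemma dvdz_expn n : (0 < n)%N -> (p%:Z %| (p ^ n)%:Z)%Z.
Proof. by move=> n0; rewrite dvdzE dvdn_exp. Qed.

Lemma expn_gt1 n : (0 < n)%N -> (1 < p ^ n)%N.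
Proof. by move=> n0; rewrite -(exp1n n) ltn_exp2r ?prime_gt1. Qed.

Definition block (q : nat) (x : int) : int := \prod_(k < q) pfree (x + k%:Z).

Lemma block_shift q x : block q (x + 1) * pfree x = block q x * pfree (x + q%:Z).
Proof.
have : \prod_(k < q.+1) pfree (x + k%:Z) = \prod_(k < q.+1) pfree (x + k%:Z) by [].
rewrite {1}big_ord_recl big_ord_recr /= addr0 mulrC => <-; congr (_ * _).
by apply: eq_bigr => i _; congr pfree; rewrite -addrA; congr (_ + _).
Qed.

Section Power.
Variable n : nat.
Hypothesis n0 : (0 < n)%N.
Let q := (p ^ n)%N.
Let hq : (p%:Z %| q%:Z)%Z. Proof. exact: dvdz_expn. Qed.

Lemma pfree_unit e x : (0 < e)%N -> ((pfree x)%:~R : 'Z_(p ^ e)) \is a GRing.unit.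
Proof. by move=> e0; apply: intr_Zp_unit => //; apply: pfree_ndvd. Qed.

Lemma block_unit e m x : (0 < e)%N -> ((block m x)%:~R : 'Z_(p ^ e)) \is a GRing.unit.
Proof.
by move=> e0; rewrite rmorph_prod unitr_prod // => i _; apply: pfree_unit.
Qed.

(** (x+2q)x and (x+q)^2 differ by q^2, which gives twice the precision of q. *)
Lemma pfree_mid x :
  (pfree (x + q%:Z + q%:Z) * pfree x)%:~R
   = ((pfree (x + q%:Z)) ^+ 2)%:~R :> 'Z_(p ^ (2 * n)).
Proof.
apply/eqP; rewrite intr_Zp_eq ?expn_gt1 ?muln_gt0 //.
rewrite -[x + q%:Z + q%:Z]addrA !pfreeD ?rpredD // /pfree; case: ifP => // _.
rewrite eqz_mod_dvd; apply/dvdzP; exists (- 1).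
by rewrite mulnC expnM PoszM; ring.
Qed.

Lemma pfree_periodic x : (pfree (x + q%:Z))%:~R = (pfree x)%:~R :> 'Z_(p ^ n).
Proof.
apply/eqP; rewrite intr_Zp_eq ?expn_gt1 //.
rewrite pfreeD // /pfree; case: ifP => // _.
by rewrite eqz_mod_dvd; apply/dvdzP; exists 1; ring.
Qed.

Lemma block_succ x : (block q (x + 1))%:~R = (block q x)%:~R :> 'Z_(p ^ n).
Proof.
apply: (mulIr (pfree_unit x n0)).
by rewrite -rmorphM block_shift rmorphM /= pfree_periodic.
Qed.

(** Sliding the window by one replaces x by x + q, which is the same residue mod q. *)
Lemma block_const x : (block q x)%:~R = (block q 0)%:~R :> 'Z_(p ^ n).
Proof.
elim: x => [//|x IH|x IH].
  by rewrite -IH (_ : x.+1%:Z = x%:Z + 1) ?block_succ //; lia.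
by rewrite -IH (_ : - x%:Z = - x.+1%:Z + 1) ?block_succ //; lia.
Qed.

Lemma block_negate : exists b : bool, block q (- q%:Z) = (-1) ^+ b * block q 0.
Proof.
have -> : block q 0 = \prod_(k < q) pfree (k%:Z + 1).
  have := block_shift q 0; rewrite add0r /pfree dvdz0 hq !mulr1 => <-.
  by apply: eq_bigr => i _; rewrite addrC.
(* Reversal pairs the window [-q, 0) with the negatives of 1, ..., q; the sign stays undetermined
   here. *)
rewrite /block (reindex_inj rev_ord_inj) /=.
have -> : \prod_(j < q) pfree (- q%:Z + (q - j.+1)%:Z) = \prod_(j < q) pfree (- (j%:Z + 1)).
  by apply: eq_bigr => i _; congr pfree; have := ltn_ord i; lia.
elim/big_ind2: _ => [|x1 x2 y1 y2 [b1 ->] [b2 ->]|i _].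
- by exists false; rewrite mul1r.
- by exists (b1 (+) b2); rewrite signr_addb; ring.
- rewrite pfreeN /pfree; case: ifP => _; first by exists false; rewrite mul1r.
  by exists true; rewrite mulN1r.
Qed.

(** The sign need not be counted: a minus would give 2 [block] q 0 = 0 mod p^n by [block_const],
    although this is a unit. *)
Lemma block_negq : block q (- q%:Z) = block q 0.
Proof.
have [[] E] := block_negate; rewrite E ?mul1r //; exfalso.
have u : ((2 * block q 0)%:~R : 'Z_(p ^ n)) \is a GRing.unit.
  rewrite rmorphM unitrM block_unit // andbT; apply: intr_Zp_unit => //.
  by apply/negP => /dvdn_leq; lia.
move: u; have := block_const (- q%:Z).
rewrite E mulN1r => e; suff -> : (2 * block q 0)%:~R = 0 :> 'Z_(p ^ n) by rewrite unitr0.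
rewrite (_ : 2 * block q 0 = block q 0 - - block q 0) ?rmorphB /= ?e ?subrr //.
by rewrite opprK mulr2n mulrDl mul1r.
Qed.

(** The precision doubles: moving by q preserves the block mod q^2. It is exact at x = -q by
    symmetry, and [pfree_mid] carries it to neighbouring x. *)
Lemma block_periodic x :
  (block q (x + q%:Z))%:~R = (block q x)%:~R :> 'Z_(p ^ (2 * n)).
Proof.
have e0 : (0 < 2 * n)%N by rewrite muln_gt0.
(* An equivalence, because x may lie on either side of the base point -q. *)
suff step y : (block q (y + q%:Z))%:~R = (block q y)%:~R :> 'Z_(p ^ (2 * n)) <->
              (block q (y + 1 + q%:Z))%:~R = (block q (y + 1))%:~R :> 'Z_(p ^ (2 * n)).
  have base : (block q (- q%:Z + q%:Z))%:~R = (block q (- q%:Z))%:~R :> 'Z_(p ^ (2 * n)).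
    by rewrite addNr block_negq.
  rewrite (_ : x = - q%:Z + (x + q%:Z)); last by lia.
  elim: (x + q%:Z) => [|m IH|m IH]; first by rewrite addr0.
    rewrite (_ : - q%:Z + m.+1%:Z = - q%:Z + m%:Z + 1); last by lia.
    exact: (step _).1.
  by apply: (step _).2; rewrite (_ : - q%:Z - m.+1%:Z + 1 = - q%:Z - m%:Z) //; lia.
have h1 := block_shift q (y + q%:Z); have h2 := block_shift q y.
have h3 := pfree_mid y.
have u1 := pfree_unit y e0; have u2 := pfree_unit (y + q%:Z) e0.
have u3 := pfree_unit (y + q%:Z + q%:Z) e0.
move/(congr1 (fun z : int => z%:~R : 'Z_(p ^ (2 * n)))): h1.
move/(congr1 (fun z : int => z%:~R : 'Z_(p ^ (2 * n)))): h2.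
move: h3; rewrite !rmorphM /= (_ : y + q%:Z + 1 = y + 1 + q%:Z); last by rewrite addrAC.
move: u1 u2 u3.
set B1 := (block q (y + 1))%:~R; set B2 := (block q (y + 1 + q%:Z))%:~R.
set B3 := (block q y)%:~R; set B4 := (block q (y + q%:Z))%:~R.
set F1 := (pfree y)%:~R; set F2 := (pfree (y + q%:Z))%:~R.
set F3 := (pfree (y + q%:Z + q%:Z))%:~R.
move=> u1 u2 u3 h3 h2 h1.
split=> [E|E].
  apply: (mulIr u2); apply: (mulIr u1).
  have -> : B2 * F2 * F1 = B4 * (F3 * F1) by rewrite h1; ring.
  have -> : B1 * F2 * F1 = B3 * F2 * F2 by rewrite -h2; ring.
  by rewrite h3 E; ring.
apply: (mulIr u2); apply: (mulIr u2).
have -> : B3 * F2 * F2 = B1 * F1 * F2 by rewrite h2.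
have -> : B4 * F2 * F2 = B2 * F2 * F1.
  by rewrite h1 -mulrA -h3; ring.
by rewrite E; ring.
Qed.
End Power.

Lemma block_mul m q x : block (m * q) x = \prod_(i < m) block q (x + (i * q)%:Z).
Proof.
elim: m => [|m IH]; first by rewrite /block big_ord0 big_ord0.
rewrite big_ord_recr /= -IH /block mulSn addnC big_split_ord /=.
by congr (_ * _); apply: eq_bigr => i _; rewrite PoszD addrA.
Qed.

(** b^p - (-1)^p is b + 1 times a sum of p terms that are all equal mod p, so one more power of p
    divides it. *)
Lemma signed_pow (b : int) n : (0 < n)%N -> b%:~R = (-1)%:~R :> 'Z_(p ^ n) ->
  (b ^+ p)%:~R = (-1)%:~R :> 'Z_(p ^ n.+1).
Proof.
move=> n0 /eqP; rewrite intr_Zp_eq ?expn_gt1 //.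
rewrite eqz_mod_dvd => /dvdzP[c /(canRL (subrK _)) ->].
apply/eqP; rewrite intr_Zp_eq ?expn_gt1 // eqz_mod_dvd.
have op : odd p by case/even_prime: pp p2 => [->|].
have sgn : (-1) ^+ p = -1 :> int by rewrite -signr_odd op.
rewrite -[X in (_ - X)]sgn subrXX addrK expnSr PoszM dvdz_mul ?dvdz_mull //.
rewrite -intr_Zp_eq0 ?prime_gt1 // rmorph_sum /=.
have cq : (c * (p ^ n)%:Z - 1)%:~R = -1 :> 'Z_p.
  have /eqP z : (c * (p ^ n)%:Z)%:~R == 0 :> 'Z_p.
    by rewrite intr_Zp_eq0 ?prime_gt1 // dvdz_mull // dvdz_expn.
  by rewrite rmorphB /= z sub0r.
rewrite (eq_bigr (fun _ => (-1) ^+ p.-1)); last first.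
  set x := c * _ - 1 in cq *.
  move=> i _; rewrite rmorphM !rmorphXn /= cq rmorphN1 -exprD subnK //.
  by rewrite -ltnS prednK ?prime_gt0.
have /eqP z : (p%:Z)%:~R == 0 :> 'Z_p by rewrite intr_Zp_eq0 ?prime_gt1 // dvdzz.
by rewrite sumr_const card_ord -mulr_natr -[p%:R]/(p%:Z%:~R) z mulr0.
Qed.

(** Wilson's theorem for powers of an odd prime. A block of length p^(n+1) consists of p blocks of
    length p^n, equal mod p^(2n), so it is a p-th power mod p^(n+1) and [signed_pow] applies. *)
Lemma wilson_block n : (0 < n)%N -> (block (p ^ n) 0)%:~R = (-1)%:~R :> 'Z_(p ^ n).
Proof.
elim: n => // -[_ _|n IH _].
  rewrite expn1; apply/eqP; rewrite intr_Zp_eq ?prime_gt1 // eqz_mod_dvd opprK.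
  have : (p %| (p.-1)`!.+1)%N by rewrite -Wilson ?prime_gt1.
  rewrite fact_prod prednK ?prime_gt0 // /block.
  rewrite -(big_mkord xpredT (fun k => pfree (0 + k%:Z))).
  rewrite [X in (_ %| X + 1)%Z]big_ltn ?prime_gt0 //.
  have -> : pfree (0 + 0%:Z) = 1 by rewrite /pfree (_ : 0 + 0%:Z = 0) // dvdz0.
  rewrite mul1r (eq_big_nat _ _ (F2 := fun i => i%:Z)).
    by rewrite -addn1 -[(_ %| _)%N]/(p%:Z %| _%:Z)%Z PoszD (big_morph Posz PoszM (erefl _)).
  move=> i /andP[i0 ip]; rewrite /pfree add0r ifF //.
  by apply/negP => /dvdn_leq -/(_ i0) /=; rewrite leqNgt ip.
have {IH}E := signed_pow (ltn0Sn n) (IH isT).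
rewrite -{}E; apply/eqP; rewrite intr_Zp_eq ?expn_gt1 //.
have -> : (p ^ n.+2 = p * p ^ n.+1)%N by rewrite expnS.
rewrite block_mul.
have dv : (p * p ^ n.+1 %| p ^ (2 * n.+1))%N by rewrite -expnS dvdn_exp2l //; lia.
suff : (\prod_(i < p) block (p ^ n.+1) (0 + (i * p ^ n.+1)%:Z) ==
        block (p ^ n.+1) 0 ^+ p %[mod (p ^ (2 * n.+1))%:Z])%Z.
  by rewrite !eqz_mod_dvd; apply: dvdz_trans; rewrite dvdzE.
rewrite -intr_Zp_eq ?expn_gt1 // rmorph_prod rmorphXn /=.
rewrite (eq_bigr (fun _ => (block (p ^ n.+1) 0)%:~R)) ?prodr_const ?card_ord //.
move=> [i _] _ /=; elim: i => [//|i IHi].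
have -> : 0 + (i.+1 * p ^ n.+1)%N%:Z = 0 + (i * p ^ n.+1)%N%:Z + (p ^ n.+1)%N%:Z.
  by rewrite mulSn; lia.
by rewrite block_periodic.
Qed.

(** * Periodicity of the Gamma products and existence of the limit *)

Lemma gam_natS m : gam_nat p m.+1 = - pfree m%:Z * gam_nat p m.
Proof.
rewrite /gam_nat big_mkcond big_nat_recr //= -big_mkcond exprS.
have -> : pfree m%:Z = if (p %| m)%N then 1 else m%:Z by [].
by case: (p %| m)%N => /=; ring.
Qed.

Lemma gam_nat_block m k : gam_nat p (m + k) = (-1) ^+ k * block k m%:Z * gam_nat p m.
Proof.
elim: k => [|k IH]; first by rewrite addn0 /block big_ord0 !mul1r.
by rewrite addnS gam_natS IH {2}/block big_ord_recr /= -/(block k m) PoszD exprS; ring.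
Qed.

(** The sign (-1)^(p^n) = -1 cancels the -1 of Wilson's theorem. *)
Lemma gam_nat_periodic n m : (gam_nat p (m + p ^ n) == gam_nat p m %[mod (p ^ n)%:Z])%Z.
Proof.
case: (posnP n) => [->|n0]; first by rewrite expn0 !modz1.
rewrite -intr_Zp_eq ?expn_gt1 // gam_nat_block rmorphM rmorphM /=.
rewrite block_const // wilson_block // -rmorphM /= -signr_odd oddX.
have -> : odd p by case/even_prime: pp p2 => [->|].
by rewrite orbT -[X in _ == X]mul1r.
Qed.

Lemma gam_nat_congr n m k : m = k %[mod p ^ n] ->
  (gam_nat p m == gam_nat p k %[mod (p ^ n)%:Z])%Z.
Proof.
have red j : (gam_nat p j == gam_nat p (j %% p ^ n) %[mod (p ^ n)%:Z])%Z.
  rewrite {1}(divn_eq j (p ^ n)); elim: (j %/ _)%N => [|d IH]; first by rewrite mul0n.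
  rewrite mulSn -addnA addnC.
  by rewrite (eqP (gam_nat_periodic n _)).
by move=> e; rewrite (eqP (red m)) e -(eqP (red k)).
Qed.

(** The choice operator gives information only once a limit is known to exist; periodicity supplies
    one, namely the value at the least residue of [x n]. The chosen limit is then determined mod p^n
    at level n. *)
Lemma Gammap_congr (x : nat -> int) : padic_seq p x -> forall n m,
  (m%:Z == x n %[mod (p ^ n)%:Z])%Z ->
  (Gammap p x n == gam_nat p m %[mod (p ^ n)%:Z])%Z.
Proof.
move=> cx.
have red n k : (n <= k)%N -> (x k == x n %[mod (p ^ n)%:Z])%Z.
  elim: k => [|k IH]; first by rewrite leqn0 => /eqP ->.
  rewrite leq_eqVlt => /orP[/eqP -> //|]; rewrite ltnS => nk.
  rewrite -(eqP (IH nk)) eqz_mod_dvd; have := cx k; rewrite eqz_mod_dvd.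
  by apply: dvdz_trans; rewrite dvdzE dvdn_exp2l.
have rep n : exists m : nat, (m%:Z == x n %[mod (p ^ n)%:Z])%Z.
  have q0 : (p ^ n)%:Z != 0 by rewrite -lt0n expn_gt0 prime_gt0.
  exists `|(x n %% (p ^ n)%:Z)%Z|%N; rewrite gez0_abs ?modz_ge0 //.
  by rewrite modz_mod.
have natE n (m k : nat) : (m%:Z == k%:Z %[mod (p ^ n)%:Z])%Z -> m = k %[mod p ^ n].
  by rewrite !modz_nat => /eqP[].
have ex : exists g : nat -> int, forall n : nat, exists N : nat, forall m : nat,
       (m%:Z == x N %[mod (p ^ N)%:Z])%Z ->
       (gam_nat p m == g n %[mod (p ^ n)%:Z])%Z.
  exists (fun n => gam_nat p `|(x n %% (p ^ n)%:Z)%Z|%N) => n; exists n => m mx.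
  apply: gam_nat_congr; apply: natE.
  rewrite (eqP mx) gez0_abs ?modz_mod //.
  by rewrite modz_ge0 // -lt0n expn_gt0 prime_gt0.
have spec := epsilon_spec (inhabits (fun _ : nat => 0 : int)) _ ex.
move=> n m mx; have [N HN] := spec n; rewrite -/(Gammap p x) in HN.
(* The level N of the specification may exceed n, so the comparison goes through a natural number
   close to x at both levels. *)
have [k kx] := rep (maxn N n).
have kr j : (j <= maxn N n)%N -> (k%:Z == x j %[mod (p ^ j)%:Z])%Z.
  move=> jm; rewrite -(eqP (red _ _ jm)) eqz_mod_dvd.
  move: kx; rewrite eqz_mod_dvd; apply: dvdz_trans.
  by rewrite dvdzE dvdn_exp2l.
rewrite -(eqP (HN k (kr _ (leq_maxl _ _)))).
apply: gam_nat_congr; apply: natE.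
by rewrite (eqP mx) (eqP (kr _ (leq_maxr _ _))).
Qed.
End Blocks.

(** * Reflection and shift formulas for Gamma_p modulo p^2 *)

Section GammaModSquare.
Variable p : nat.
Hypothesis pp : prime p.
Hypothesis p2 : (2 < p)%N.
Local Notation R := 'Z_(p ^ 2).

(** Gamma_p at any integer, negative ones included, through the residue mod p^3, the precision of
    the theorem. Values mod p^2 suffice because the closed form carries a factor p. *)
Definition gam_mod (x : int) : R := (gam_nat p `|(x %% (p ^ 3)%:Z)%Z|%N)%:~R.

Lemma gam_mod_congr x y : (x == y %[mod (p ^ 3)%:Z])%Z -> gam_mod x = gam_mod y.
Proof. by rewrite /gam_mod => /eqP ->. Qed.

Lemma intr_Zp_le (a b : nat) (x y : int) : (0 < a)%N -> (a <= b)%N ->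
  (x == y %[mod (p ^ b)%:Z])%Z -> x%:~R = y%:~R :> 'Z_(p ^ a).
Proof.
move=> a0 ab; rewrite eqz_mod_dvd => d; apply/eqP.
rewrite intr_Zp_eq ?expn_gt1 // eqz_mod_dvd; apply: dvdz_trans d.
by rewrite dvdzE dvdn_exp2l.
Qed.

Lemma absz_modz_expn (x : int) : `|(x %% (p ^ 3)%:Z)%Z|%N%:Z = (x %% (p ^ 3)%:Z)%Z.
Proof. by rewrite gez0_abs // modz_ge0 // -lt0n expn_gt0 prime_gt0. Qed.

Lemma gam_mod_nat (m : nat) : gam_mod m = (gam_nat p m)%:~R.
Proof.
apply: (@intr_Zp_le 2 3) => //; apply: gam_nat_congr => //.
by rewrite modz_nat /= modn_mod.
Qed.

Lemma gam_mod_rep x : exists m : nat, (x == m%:Z %[mod (p ^ 3)%:Z])%Z.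
Proof. by exists `|(x %% (p ^ 3)%:Z)%Z|%N; rewrite absz_modz_expn modz_mod. Qed.

Lemma gam_mod_unit x : gam_mod x \is a GRing.unit.
Proof.
rewrite /gam_mod; elim: `|_|%N => [|m IH].
  by rewrite /gam_nat big_geq // mulr1 unitr1.
by rewrite gam_natS rmorphM rmorphN /= unitrM unitrN IH pfree_unit.
Qed.

Lemma gam_mod0 : gam_mod 0 = 1.
Proof. by rewrite (gam_mod_nat 0) /gam_nat big_geq. Qed.

Lemma gam_modS x : gam_mod (x + 1) = - (pfree p x)%:~R * gam_mod x.
Proof.
have [m xm] := gam_mod_rep x.
rewrite (gam_mod_congr xm) gam_mod_nat.
have -> : gam_mod (x + 1) = gam_mod m.+1.
  apply: gam_mod_congr; move: xm; rewrite !eqz_mod_dvd.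
  by rewrite (_ : x + 1 - m.+1%:Z = x - m%:Z) //; lia.
rewrite gam_mod_nat gam_natS rmorphM rmorphN /=; congr (- _ * _).
apply: esym; rewrite /pfree.
have d3 : (p%:Z %| x - m%:Z)%Z.
  by apply: (@dvdz_trans (p ^ 3)%:Z); rewrite ?dvdz_expn // -eqz_mod_dvd.
rewrite -[x in (_ %| x)%Z](subrK m%:Z) rpredDl //; case: ifP => // _.
exact: (@intr_Zp_le 2 3).
Qed.

Lemma gam_mod_reflS x : gam_mod (x + 1) * gam_mod (1 - (x + 1)) =
  (if (p%:Z %| x)%Z then 1 else -1) * (gam_mod x * gam_mod (1 - x)).
Proof.
have -> : 1 - (x + 1) = - x by ring.
rewrite (_ : 1 - x = - x + 1); last by ring.
rewrite !gam_modS pfreeN /pfree; case: ifP => _; last by rewrite rmorphN /=; ring.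
by rewrite /=; ring.
Qed.

(** Gamma_p(x) Gamma_p(1-x) changes sign at each unit step, except when leaving a multiple of p. It
    is -1 at 0, and a full period has p - 1 sign changes, an even number. *)
Lemma gam_mod_refl (x : int) (a : nat) : (0 < a <= p)%N ->
  (p%:Z %| x - a%:Z)%Z -> gam_mod x * gam_mod (1 - x) = (-1) ^+ a.
Proof.
move=> apb.
have op : odd p by case/even_prime: pp p2 => [->|].
have step (y : int) : (p%:Z %| y)%Z -> gam_mod y * gam_mod (1 - y) = -1 ->
    forall j : nat, (0 < j <= p)%N -> gam_mod (y + j%:Z) * gam_mod (1 - (y + j%:Z)) = (-1) ^+ j.
  move=> py y1; elim=> // j IH /andP[_ jp].
  rewrite (_ : y + j.+1%:Z = y + j%:Z + 1); last by lia.
  rewrite gam_mod_reflS; case: (posnP j) => [->|j0].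
    by rewrite addr0 py mul1r y1.
  rewrite rpredDl // ifF; last by apply/negP => /dvdn_leq; rewrite /= => /(_ j0); lia.
  have jb : (0 < j <= p)%N by rewrite j0 ltnW.
  by rewrite (IH jb) exprS.
have base (T : nat) : gam_mod (T * p)%:Z * gam_mod (1 - (T * p)%:Z) = -1.
  elim: T => [|T IH].
    rewrite mul0n subr0 gam_mod0 mul1r (_ : 1 = 0 + 1) // gam_modS gam_mod0 /pfree dvdz0.
    by rewrite mulr1.
  have -> : (T.+1 * p)%N%:Z = (T * p)%N%:Z + p%:Z by rewrite mulSn; lia.
  rewrite step ?leqnn ?prime_gt0 //; last by rewrite dvdzE dvdn_mull.
  by rewrite -signr_odd op.
(* The representative is enlarged by p^3 so that m - a is a natural number. *)
have [m [am xm]] : exists m : nat, (a <= m)%N /\ (x == m%:Z %[mod (p ^ 3)%:Z])%Z.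
  have [m xm] := gam_mod_rep x; exists (m + p ^ 3)%N; split.
    case/andP: apb => _ ap; apply: leq_trans ap (leq_trans _ (leq_addl _ _)).
    by rewrite -{1}(expn1 p) leq_exp2l ?prime_gt1.
  by rewrite PoszD modzDr.
move=> dx; rewrite (gam_mod_congr xm).
rewrite (@gam_mod_congr (1 - x) (1 - m%:Z)); last first.
  move: xm; rewrite !eqz_mod_dvd => /dvdzP[c e].
  by apply/dvdzP; exists (- c); rewrite mulNr -e; ring.
have d : (p %| m - a)%N.
  rewrite -[(_ %| _)%N]/(p%:Z %| (m - a)%N%:Z)%Z -subzn //.
  have -> : m%:Z - a%:Z = (x - a%:Z) - (x - m%:Z) by ring.
  rewrite rpredB //; move: xm; rewrite eqz_mod_dvd; apply: dvdz_trans.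
  exact: dvdz_expn.
have -> : m%:Z = ((m - a) %/ p * p)%N%:Z + a%:Z.
  by rewrite divnK //; lia.
by apply: step => //; rewrite ?dvdzE ?dvdn_mull.
Qed.

(* As (x+pT)(x-pT) = x^2 mod p^2, both sides obey the same recurrence in x. *)
Lemma gam_mod_shift (x : int) (T : nat) :
  gam_mod (x + (p * T)%:Z) * gam_mod (x - (p * T)%:Z) = gam_mod x ^+ 2.
Proof.
set t := (p * T)%N%:Z.
have pt : (p%:Z %| t)%Z by rewrite dvdzE dvdn_mulr.
have [m xm] := gam_mod_rep x.
have cong z : gam_mod (x + z) = gam_mod (m%:Z + z).
  apply: gam_mod_congr; move: xm; rewrite !eqz_mod_dvd.
  by rewrite (_ : x + z - (m%:Z + z) = x - m%:Z) //; ring.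
rewrite !cong (gam_mod_congr xm) {x xm cong}.
elim: m => [|m IH].
  (* Base case x = 0: reflection gives Gamma(t) Gamma(1-t) = -1, and Gamma(1-t) = -Gamma(-t) since p
     divides t. *)
  have r : gam_mod t * gam_mod (1 - t) = -1.
    rewrite (gam_mod_refl (a := p)) ?leqnn ?prime_gt0 ?rpredB //.
    by rewrite -signr_odd; case/even_prime: pp p2 => [->|->].
  rewrite (_ : 1 - t = - t + 1) in r; last by ring.
  move: r; rewrite gam_modS pfreeN pt mulN1r mulrN => /oppr_inj.
  by rewrite !add0r gam_mod0 expr1n.
have -> : m.+1%:Z + t = m%:Z + t + 1 by lia.
have -> : m.+1%:Z - t = m%:Z - t + 1 by lia.
rewrite (_ : m.+1%:Z = m%:Z + 1); last by lia.
rewrite !gam_modS exprMn sqrrN -IH.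
suff -> : (pfree p m%:Z)%:~R ^+ 2 =
  (pfree p (m%:Z + t))%:~R * (pfree p (m%:Z - t))%:~R :> R by ring.
rewrite pfreeD // pfreeD ?rpredN // /pfree; case: ifP => _; first by rewrite expr2.
rewrite -rmorphXn -rmorphM; apply: (@intr_Zp_le 2 2) => //.
rewrite eqz_mod_dvd (_ : m%:Z ^+ 2 - (m%:Z + t) * (m%:Z - t) = t ^+ 2); last by ring.
by rewrite /t PoszM exprMn -[(p ^ 2)%N%:Z]/(Posz p * Posz p) dvdz_mulr.
Qed.

Lemma gam_mod_poch x m : (forall j, (j < m)%N -> ~~ (p%:Z %| x + j%:Z)%Z) ->
  (\prod_(j < m) (x + j%:Z))%:~R * gam_mod x = (-1) ^+ m * gam_mod (x + m%:Z).
Proof.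
elim: m => [|m IH] h; first by rewrite big_ord0 !mul1r addr0.
rewrite big_ord_recr rmorphM /= mulrAC IH; last by move=> j jm; apply: h; apply: ltnW.
rewrite (_ : x + m.+1%:Z = x + m%:Z + 1); last by lia.
by rewrite gam_modS /pfree (negPf (h m _)) // exprS; ring.
Qed.
End GammaModSquare.

(** * The closed form in terms of Gamma values *)

Lemma dvdz_small (p : nat) (z : int) : (p%:Z %| z)%Z ->
  - p%:Z < z -> z < 2 * p%:Z -> z = 0 \/ z = p%:Z.
Proof.
move=> /dvdzP[k ->] h1 h2.
have k1 : -1 < k by nia.
have k2 : k < 2 by nia.
have [->|->] : k = 0 \/ k = 1 by lia.
  by left; rewrite mul0r.
by right; rewrite mul1r.
Qed.

(** The arguments are quarters mod p, so divisibility is tested on 4x, which is congruent to an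
    integer c of known size. *)
Lemma ndvdz_of_quadruple (p : nat) (x c : int) : (p%:Z %| 4 * x - c)%Z ->
  - p%:Z < c -> c < 2 * p%:Z -> c <> 0 -> c <> p%:Z -> ~~ (p%:Z %| x)%Z.
Proof.
move=> d h1 h2 c0 cp; apply/negP => dx.
have : (p%:Z %| c)%Z.
  have -> : c = 4 * x - (4 * x - c) by ring.
  by rewrite rpredB ?dvdz_mull.
by case/dvdz_small.
Qed.

(** The values c are four times the first factors of the six Pochhammer symbols, with alpha replaced
    by its residue. Mod 4, c + 4j is 0, 2 or 3, hence never P; those divisible by 4 are positive. *)
Lemma quadruple_bounds (P : int) (m a j : nat) (c : int) : P = 4 * m%:Z + 1 ->
  (a <= m)%N -> (j < m)%N ->
  (c = 2 \/ c = 2 - 4 * a%:Z \/ c = 3 + 4 * a%:Z \/ c = 4 \/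
    c = 4 + 4 * a%:Z \/ c = 3 - 4 * a%:Z) ->
  [/\ - P < c + 4 * j%:Z, c + 4 * j%:Z < 2 * P, c + 4 * j%:Z <> 0 & c + 4 * j%:Z <> P].
Proof.
by move=> -> am jm; case=> [|[|[|[|[|]]]]] ->; split; lia.
Qed.

Lemma refl_index_range (m c : nat) : (c <= m)%N -> (0 < 2 * m + 1 + c <= 4 * m + 1)%N.
Proof. lia. Qed.

(** Elimination among Gamma values. The X and Y are the Pochhammer symbols of numerator and
    denominator; the R are reflections and the S shift identities. A final p or m in a name marks an
    argument moved by plus or minus p/4. *)
Lemma gamma_algebra (R : comUnitRingType)
  (c sa sb X1 X2 X3 Y1 Y2 Y3 g2 g2A' g3A' g1A g3A gqp gqm gq gqAp gqAm gqA g2Ap g2Am g2A h1 h2 h3 : R) :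
  sa * sa = 1 -> sb * sb = 1 ->
  X1 * g2 = sa * sb * gqp -> X2 * g2A' = sa * sb * gqAp -> X3 * g3A' = sa * sb * g2Ap ->
  Y1 * -1 = sa * sb * h1 -> Y2 * g1A = sa * sb * h2 -> Y3 * g3A = sa * sb * h3 ->
  g2 * g2 = -1 -> g2A * g2A' = - sa -> gqA * g3A' = - sb ->
  gqm * h1 = - (sa * sb) -> gqAm * h2 = - sb -> g2Am * h3 = - sa ->
  gqp * gqm = gq ^+ 2 -> gqAp * gqAm = gqA ^+ 2 -> g2Ap * g2Am = g2A ^+ 2 ->
  gqm \is a GRing.unit -> gqAm \is a GRing.unit -> g2Am \is a GRing.unit ->
  c * X1 * X2 * X3 = c * Y1 * Y2 * Y3 *
    (-1 * (sa * sb) * g2 * gq ^+ 2 * g1A * g3A * g2A ^+ 3 * gqA ^+ 3).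
Proof.
move=> saa sbb E1 E2 E3 F1 F2 F3 R1 R2 R3 R4 R5 R6 S1 S2 S3 U1 U2 U3.
have x1 : X1 = - (sa * sb * gqp * g2).
  by rewrite -E1 -mulrA R1; ring.
have x2 : X2 = - (sb * gqAp * g2A).
  have -> : X2 = (sa * sa) * X2 by rewrite saa mul1r.
  transitivity (- sa * (X2 * (g2A * g2A'))); first by rewrite R2; ring.
  transitivity (- sa * (X2 * g2A') * g2A); first by ring.
  transitivity (- ((sa * sa) * (sb * gqAp * g2A))); first by rewrite E2; ring.
  by rewrite saa; ring.
have x3 : X3 = - (sa * g2Ap * gqA).
  have -> : X3 = (sb * sb) * X3 by rewrite sbb mul1r.
  transitivity (- sb * (X3 * (gqA * g3A'))); first by rewrite R3; ring.
  transitivity (- sb * (X3 * g3A') * gqA); first by ring.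
  transitivity (- ((sb * sb) * (sa * g2Ap * gqA))); first by rewrite E3; ring.
  by rewrite sbb; ring.
have y1 : Y1 * gqm = 1.
  transitivity (- (Y1 * -1) * gqm); first by ring.
  transitivity (- (sa * sb) * (gqm * h1)); first by rewrite F1; ring.
  transitivity ((sa * sa) * (sb * sb)); first by rewrite R4; ring.
  by rewrite saa sbb mulr1.
have y2 : Y2 * g1A * gqAm = - sa.
  transitivity (sa * sb * (gqAm * h2)); first by rewrite F2; ring.
  transitivity (- sa * (sb * sb)); first by rewrite R5; ring.
  by rewrite sbb mulr1.
have y3 : Y3 * g3A * g2Am = - sb.
  transitivity (sa * sb * (g2Am * h3)); first by rewrite F3; ring.
  transitivity (- sb * (sa * sa)); first by rewrite R6; ring.
  by rewrite saa mulr1.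
(* Multiplying by the three values moved by -p/4 completes the pairs, which the shift identities
   turn into squares. *)
apply: (mulIr U1); apply: (mulIr U2); apply: (mulIr U3).
transitivity (c * (sa * sb) * - (sa * sb) * g2 * g2A * gqA * (gqp * gqm) * (gqAp * gqAm) * (g2Ap * g2Am)).
  by rewrite x1 x2 x3; ring.
transitivity (c * (Y1 * gqm) * (Y2 * g1A * gqAm) * (Y3 * g3A * g2Am) *
   (-1 * (sa * sb) * g2 * gq ^+ 2 * g2A ^+ 3 * gqA ^+ 3)); last by ring.
by rewrite S1 S2 S3 y1 y2 y3; ring.
Qed.

Section GammaFormula.
Variables (p m A q : nat).
Hypothesis pp : prime p.
Hypothesis pE : p = (4 * m + 1)%N.
Hypothesis Am : (A %% p <= m)%N.
Hypothesis q4 : (4 * q%:Z == 1 %[mod (p ^ 3)%:Z])%Z.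
Local Notation R := 'Z_(p ^ 2).
Local Notation G := (gam_mod p).

Let m0 : (0 < m)%N.
Proof. by case: m pE pp => [->|]. Qed.

Let p2 : (2 < p)%N.
Proof. by rewrite pE; have := m0; lia. Qed.

Let a := (A %% p)%N.
Let Aa : (p%:Z %| A%:Z - a%:Z)%Z.
Proof.
rewrite /a {1}(divn_eq A p) PoszD addrK; apply/dvdzP.
by exists (A %/ p)%N%:Z; rewrite PoszM.
Qed.

Let q4p : (p%:Z %| 4 * q%:Z - 1)%Z.
Proof.
by move: q4; rewrite eqz_mod_dvd; apply: dvdz_trans; apply: dvdz_expn.
Qed.

(** With q in the role of 1/4, m = (p-1)/4 is congruent to pq - q. The endpoint x + m of a
    Pochhammer symbol thus becomes x - 1/4 + p/4, the source of the shifts by pq. *)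
Let mE x y : y = x - q%:Z + (p * q)%N%:Z -> G (x + m%:Z) = G y.
Proof.
move=> ->; apply: gam_mod_congr; move: q4; rewrite !eqz_mod_dvd => /dvdzP[c e].
apply/dvdzP; exists (- m%:Z * c).
rewrite -mulrA -e PoszM pE PoszD PoszM.
ring.
Qed.

Let poch x c m' : (m' <= m)%N -> (p%:Z %| 4 * x - c)%Z ->
  (forall j, (j < m)%N -> [/\ - p%:Z < c + 4 * j%:Z, c + 4 * j%:Z < 2 * p%:Z,
     c + 4 * j%:Z <> 0 & c + 4 * j%:Z <> p%:Z]) ->
  (\prod_(j < m') (x + j%:Z))%:~R * G x = (-1) ^+ m' * G (x + m'%:Z).
Proof.
move=> mm d h; apply: gam_mod_poch => // j jm.
have [h1 h2 h3 h4] := h j (leq_trans jm mm).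
apply: (ndvdz_of_quadruple (c := c + 4 * j%:Z)) => //.
by rewrite (_ : _ - _ = 4 * x - c) //; ring.
Qed.

Lemma gamma_formula :
  (\prod_(j < m) ((4 * j%:Z + 2) * (4 * j%:Z + 2 - 4 * A%:Z) * (4 * j%:Z + 3 + 4 * A%:Z)))%:~R =
  (\prod_(j < m) ((4 * j%:Z + 4) * (4 * j%:Z + 4 + 4 * A%:Z) * (4 * j%:Z + 3 - 4 * A%:Z)))%:~R
  * ((-1) ^+ m.+1 * G (2 * q%:Z) * G q%:Z ^+ 2 * G (1 + A%:Z) * G (3 * q%:Z - A%:Z)
     * G (2 * q%:Z + A%:Z) ^+ 3 * G (q%:Z - A%:Z) ^+ 3) :> R.
Proof.
have q4R : 4 * q%:R = 1 :> R.
  have := @intr_Zp_le p pp 2 3 _ _ isT isT q4.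
  by rewrite rmorphM.
have am : (a <= m)%N by [].
have [kA kAE] : exists k : int, A%:Z = a%:Z + k * p%:Z.
  by case/dvdzP: Aa => k e; exists k; rewrite -e; ring.
(* 1/4 is congruent to -m mod p; with this explicit quotient every later divisibility is a [ring]
   identity. *)
have [k kE] : exists k : int, q%:Z = k * p%:Z - m%:Z.
  case/dvdzP: q4p => c e; exists (q%:Z - m%:Z * c).
  rewrite mulrBl -mulrA -e pE PoszD PoszM; ring.
have PE : p%:Z = 4 * m%:Z + 1 by rewrite {1}pE PoszD PoszM.
have -> : (\prod_(j < m) ((4 * j%:Z + 2) * (4 * j%:Z + 2 - 4 * A%:Z) * (4 * j%:Z + 3 + 4 * A%:Z)))%:~R
  = 64 ^+ m * (\prod_(j < m) (2 * q%:Z + j%:Z))%:~R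
    * (\prod_(j < m) (2 * q%:Z - A%:Z + j%:Z))%:~R
    * (\prod_(j < m) (3 * q%:Z + A%:Z + j%:Z))%:~R :> R.
  rewrite -[m in 64 ^+ m]card_ord -prodr_const !rmorph_prod -!big_split /=.
  apply: eq_bigr => j _; rewrite !(rmorphM, rmorphD, rmorphB, rmorphN) /=.
  transitivity ((4 * j%:R + 2 * (4 * q%:R)) * (4 * j%:R + 2 * (4 * q%:R) - 4 * A%:R)
    * (4 * j%:R + 3 * (4 * q%:R) + 4 * A%:R) : R).
    by rewrite q4R !mulr1.
  ring.
have -> : (\prod_(j < m) ((4 * j%:Z + 4) * (4 * j%:Z + 4 + 4 * A%:Z) * (4 * j%:Z + 3 - 4 * A%:Z)))%:~R
  = 64 ^+ m * (\prod_(j < m) (1 + j%:Z))%:~R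
    * (\prod_(j < m) (1 + A%:Z + j%:Z))%:~R
    * (\prod_(j < m) (3 * q%:Z - A%:Z + j%:Z))%:~R :> R.
  rewrite -[m in 64 ^+ m]card_ord -prodr_const !rmorph_prod -!big_split /=.
  apply: eq_bigr => j _; rewrite !(rmorphM, rmorphD, rmorphB, rmorphN) /=.
  transitivity ((4 * j%:R + 4) * (4 * j%:R + 4 + 4 * A%:R)
    * (4 * j%:R + 3 * (4 * q%:R) - 4 * A%:R) : R).
    by rewrite q4R !mulr1.
  ring.
(* With m = a + b, the residues of 1/2 + alpha and 1/4 - alpha in 1, ..., p are 2m + 1 + a and 2m +
   1 + b; these fix the reflection signs. *)
have [b mab] : exists b : nat, m = (a + b)%N by exists (m - a)%N; rewrite subnKC.
have bnd c : (c = 2 \/ c = 2 - 4 * a%:Z \/ c = 3 + 4 * a%:Z \/ c = 4 \/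
    c = 4 + 4 * a%:Z \/ c = 3 - 4 * a%:Z) ->
  forall j : nat, (j < m)%N -> [/\ - p%:Z < c + 4 * j%:Z, c + 4 * j%:Z < 2 * p%:Z,
     c + 4 * j%:Z <> 0 & c + 4 * j%:Z <> p%:Z].
  by move=> hc j jm; apply: (quadruple_bounds PE _ _ hc).
have dv (z w : int) : z = w * p%:Z -> (p%:Z %| z)%Z by move=> ->; apply: dvdz_mull.
set t := (p * q)%N; have tE : t%:Z = p%:Z * q%:Z by rewrite /t PoszM.
(* 1 - 4q vanishes mod p^3, so for instance 1 - 1/2 may be exchanged with 1/2. *)
have flip x y : y = x + (1 - 4 * q%:Z) -> G x = G y.
  move=> ->; apply: gam_mod_congr; move: q4; rewrite !eqz_mod_dvd => /dvdzP[c e].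
  apply/dvdzP; exists c; rewrite -e; ring.
have E1 := poch (leqnn m) (dv (4 * (2 * q%:Z) - 2) (8 * k - 2) _) (bnd _ _).
have E2 := poch (leqnn m) (dv (4 * (2 * q%:Z - A%:Z) - (2 - 4 * a%:Z)) (8 * k - 2 - 4 * kA) _) (bnd _ _).
have E3 := poch (leqnn m) (dv (4 * (3 * q%:Z + A%:Z) - (3 + 4 * a%:Z)) (12 * k - 3 + 4 * kA) _) (bnd _ _).
have F1 := poch (leqnn m) (dv (4 * 1 - 4) 0 _) (bnd _ _).
have F2 := poch (leqnn m) (dv (4 * (1 + A%:Z) - (4 + 4 * a%:Z)) (4 * kA) _) (bnd _ _).
have F3 := poch (leqnn m) (dv (4 * (3 * q%:Z - A%:Z) - (3 - 4 * a%:Z)) (12 * k - 3 - 4 * kA) _) (bnd _ _).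
have {}E1 : (\prod_(j < m) (2 * q%:Z + j%:Z))%:~R * G (2 * q%:Z) = (-1) ^+ m * G (q%:Z + t%:Z).
  rewrite {}E1; [|by rewrite kE PE; ring|by tauto].
  by congr (_ * _); apply: mE; rewrite -/t; ring.
have {}E2 : (\prod_(j < m) (2 * q%:Z - A%:Z + j%:Z))%:~R * G (2 * q%:Z - A%:Z) =
    (-1) ^+ m * G (q%:Z - A%:Z + t%:Z).
  rewrite {}E2; [|by rewrite kE kAE PE; ring|by tauto].
  by congr (_ * _); apply: mE; rewrite -/t; ring.
have {}E3 : (\prod_(j < m) (3 * q%:Z + A%:Z + j%:Z))%:~R * G (3 * q%:Z + A%:Z) =
    (-1) ^+ m * G (2 * q%:Z + A%:Z + t%:Z).
  rewrite {}E3; [|by rewrite kE kAE PE; ring|by tauto].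
  by congr (_ * _); apply: mE; rewrite -/t; ring.
have {}F1 : (\prod_(j < m) (1 + j%:Z))%:~R * G 1 = (-1) ^+ m * G (1 - (q%:Z - t%:Z)).
  rewrite {}F1; [|by []|by tauto].
  by congr (_ * _); apply: mE; rewrite -/t; ring.
have {}F2 : (\prod_(j < m) (1 + A%:Z + j%:Z))%:~R * G (1 + A%:Z) =
    (-1) ^+ m * G (1 - (q%:Z - A%:Z - t%:Z)).
  rewrite {}F2; [|by rewrite kAE PE; ring|by tauto].
  by congr (_ * _); apply: mE; rewrite -/t; ring.
have {}F3 : (\prod_(j < m) (3 * q%:Z - A%:Z + j%:Z))%:~R * G (3 * q%:Z - A%:Z) =
    (-1) ^+ m * G (1 - (2 * q%:Z + A%:Z - t%:Z)).
  rewrite {}F3; [|by rewrite kE kAE PE; ring|by tauto].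
  congr (_ * _); rewrite (mE (y := 2 * q%:Z - A%:Z + t%:Z)); last by rewrite -/t; ring.
  by apply: flip; ring.
have sgn c : (-1) ^+ (2 * m + 1 + c) = - (-1) ^+ c :> R.
  by rewrite exprD exprD exprM sqrrN !expr1n expr1 mul1r mulN1r.
have rb c : (c <= m)%N -> (0 < 2 * m + 1 + c <= p)%N by rewrite pE; apply: refl_index_range.
have castE c : (2 * m + 1 + c)%N%:Z = 2 * m%:Z + 1 + c%:Z by rewrite 2!PoszD PoszM.
have bm : (b <= m)%N by rewrite mab leq_addl.
have mZ : m%:Z = a%:Z + b%:Z by rewrite {1}mab.
have R1 : G (2 * q%:Z) * G (2 * q%:Z) = -1.
  rewrite {2}(flip (2 * q%:Z) (1 - 2 * q%:Z)); last by ring.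
  rewrite (gam_mod_refl pp p2 (rb 0%N _)) ?sgn ?expr0 //.
  by apply: (dv _ (2 * k - 1)); rewrite kE castE PE; ring.
have R2 : G (2 * q%:Z + A%:Z) * G (2 * q%:Z - A%:Z) = - (-1) ^+ a.
  rewrite (flip (2 * q%:Z - A%:Z) (1 - (2 * q%:Z + A%:Z))); last by ring.
  rewrite (gam_mod_refl pp p2 (rb a _)) ?sgn //.
  by apply: (dv _ (2 * k - 1 + kA)); rewrite kE kAE castE PE; ring.
have R3 : G (q%:Z - A%:Z) * G (3 * q%:Z + A%:Z) = - (-1) ^+ b.
  rewrite (flip (3 * q%:Z + A%:Z) (1 - (q%:Z - A%:Z))); last by ring.
  rewrite (gam_mod_refl pp p2 (rb b _)) ?sgn //.
  by apply: (dv _ (k - 1 - kA)); rewrite kE kAE castE PE mZ; ring.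
have R4 : G (q%:Z - t%:Z) * G (1 - (q%:Z - t%:Z)) = - (-1) ^+ m.
  rewrite (gam_mod_refl pp p2 (rb m _)) ?sgn //.
  by apply: (dv _ (k - q%:Z - 1)); rewrite tE kE castE PE; ring.
have R5 : G (q%:Z - A%:Z - t%:Z) * G (1 - (q%:Z - A%:Z - t%:Z)) = - (-1) ^+ b.
  rewrite (gam_mod_refl pp p2 (rb b _)) ?sgn //.
  by apply: (dv _ (k - 1 - kA - q%:Z)); rewrite tE kE kAE castE PE mZ; ring.
have R6 : G (2 * q%:Z + A%:Z - t%:Z) * G (1 - (2 * q%:Z + A%:Z - t%:Z)) = - (-1) ^+ a.
  rewrite (gam_mod_refl pp p2 (rb a _)) ?sgn //.
  by apply: (dv _ (2 * k - 1 + kA - q%:Z)); rewrite tE kE kAE castE PE; ring.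
have S1 := gam_mod_shift pp p2 q%:Z q.
have S2 := gam_mod_shift pp p2 (q%:Z - A%:Z) q.
have S3 := gam_mod_shift pp p2 (2 * q%:Z + A%:Z) q.
have G1 : G 1 = -1.
  have -> : G 1 = - (pfree p 0)%:~R * G 0 by rewrite -gam_modS // add0r.
  have -> : pfree p 0 = 1 by rewrite /pfree dvdz0.
  by rewrite (gam_mod0 pp p2) mulr1.
have U1 := gam_mod_unit pp (q%:Z - t%:Z).
have U2 := gam_mod_unit pp (q%:Z - A%:Z - t%:Z).
have U3 := gam_mod_unit pp (2 * q%:Z + A%:Z - t%:Z).
have ss : (-1) ^+ m = (-1) ^+ a * (-1) ^+ b :> R by rewrite -exprD -mab.
have saa : (-1) ^+ a * (-1) ^+ a = 1 :> R by rewrite -exprMn mulrNN mulr1 expr1n.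
have sbb : (-1) ^+ b * (-1) ^+ b = 1 :> R by rewrite -exprMn mulrNN mulr1 expr1n.
move: E1 E2 E3 F1 F2 F3 R1 R2 R3 R4 R5 R6 S1 S2 S3 U1 U2 U3.
rewrite -/t (exprS (-1) m) ss G1.
move: saa sbb.
set sa := (-1) ^+ a; set sb := (-1) ^+ b.
set X1 := (\prod_(j < m) (2 * q%:Z + j%:Z))%:~R.
set X2 := (\prod_(j < m) (2 * q%:Z - A%:Z + j%:Z))%:~R.
set X3 := (\prod_(j < m) (3 * q%:Z + A%:Z + j%:Z))%:~R.
set Y1 := (\prod_(j < m) (1 + j%:Z))%:~R.
set Y2 := (\prod_(j < m) (1 + A%:Z + j%:Z))%:~R.
set Y3 := (\prod_(j < m) (3 * q%:Z - A%:Z + j%:Z))%:~R.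
exact: gamma_algebra.
Qed.
End GammaFormula.

(** * Divisibility by interpolation *)

Definition ratio_num (A : nat) (w : int) (j : nat) : int :=
  (2 * j%:Z + 1) * (4 * j%:Z + 1) * (2 * A%:Z + 1 + 2 * j%:Z) * (4 * j%:Z + 1 - 4 * A%:Z)
  * ((2 * j%:Z + 1) ^+ 2 - w).
Definition ratio_den (A : nat) (w : int) (j : nat) : int :=
  8 * (j%:Z + 1) ^+ 2 * (2 * j%:Z + 1 - 4 * A%:Z) * (2 * A%:Z + 1 + j%:Z)
  * (16 * (j%:Z + 1) ^+ 2 - w).
(** All M denominators are multiplied in: the k-th term keeps k numerators and the M - k
    denominators it lacks, so the result is a polynomial in w of degree at most M. *)
Definition cleared_sum (A M : nat) (w : int) : int :=
  \sum_(k < M.+1) (6 * k%:Z + 1) *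
    \prod_(j < M) (if (j < k)%N then ratio_num A w j else ratio_den A w j).

Lemma prod_split_ratio (K : fieldType) (M k : nat) (f g : nat -> K) : (k <= M)%N ->
  (forall j, g j != 0) ->
  \prod_(j < M) (if (j < k)%N then f j else g j)
  = \prod_(j < k) (f j / g j) * \prod_(j < M) g j.
Proof.
move=> kM g0; rewrite (big_ord_widen _ (fun j => f j / g j) kM) [X in _ = X * _]big_mkcond -big_split /=.
by apply: eq_bigr => j _; case: ifP => _; rewrite ?mul1r // mulfVK.
Qed.

Lemma cleared_sum_hyper_sum A M (w : int) : (forall j, ratio_den A w j != 0) ->
  (cleared_sum A M w)%:~R = hyper_sum A%:R w%:~R M.+1 * (\prod_(j < M) ratio_den A w j)%:~R :> rat.
Proof.
move=> b0; rewrite /cleared_sum /hyper_sum rmorph_sum mulr_suml; apply: eq_bigr => k _.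
rewrite rmorphM !rmorph_prod /= -mulrA; congr (_ * _).
  by rewrite rmorphD rmorphM.
under eq_bigr => j _ do rewrite fun_if.
rewrite (prod_split_ratio (fun j => (ratio_num A w j)%:~R) (g := fun j => (ratio_den A w j)%:~R)).
- congr (_ * _); apply: eq_bigr => j _; rewrite /term_ratio /ratio_num /ratio_den.
  by rewrite !(rmorphM, rmorphD, rmorphB, rmorphN, rmorphXn).
- by rewrite -ltnS.
- by move=> j; rewrite intr_eq0.
Qed.

(** At an odd square w the last factor splits into two odd integers. *)
Lemma ratio_den_neq0 A (N : nat) j : ratio_den A ((2 * N%:Z + 1) ^+ 2) j != 0.
Proof.
rewrite /ratio_den (_ : 16 * _ - _ = (4 * j%:Z + 3 - 2 * N%:Z) * (4 * j%:Z + 5 + 2 * N%:Z)); last by ring.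
rewrite !mulf_neq0 ?sqrf_eq0 //; lia.
Qed.

Definition value_num (A s : nat) : int :=
  \prod_(j < s) ((4 * j%:Z + 2) * (4 * j%:Z + 2 - 4 * A%:Z) * (4 * j%:Z + 3 + 4 * A%:Z)).
Definition value_den (A s : nat) : int :=
  \prod_(j < s) ((4 * j%:Z + 4) * (4 * j%:Z + 4 + 4 * A%:Z) * (4 * j%:Z + 3 - 4 * A%:Z)).

Lemma cleared_sum_odd A M s : (s.*2.+1 <= M)%N -> cleared_sum A M ((2 * s.*2.+1%:Z + 1) ^+ 2) = 0.
Proof.
move=> sM; apply/eqP; rewrite -(intr_eq0 rat) cleared_sum_hyper_sum; last exact: ratio_den_neq0.
have -> : ((2 * s.*2.+1%:Z + 1) ^+ 2)%:~R = (2 * s.*2.+1%:R + 1) ^+ 2 :> rat.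
  by rewrite rmorphXn rmorphD rmorphM.
by rewrite hyper_sum_odd ?ltnS // mul0r.
Qed.

Lemma cleared_sum_even A M s : (s.*2 <= M)%N ->
  cleared_sum A M ((2 * s.*2%:Z + 1) ^+ 2) * value_den A s =
  (4 * s%:Z + 1) * value_num A s * \prod_(j < M) ratio_den A ((2 * s.*2%:Z + 1) ^+ 2) j.
Proof.
move=> sM; apply: (@intr_inj rat); rewrite !rmorphM /= cleared_sum_hyper_sum; last exact: ratio_den_neq0.
have -> : ((2 * s.*2%:Z + 1) ^+ 2)%:~R = (2 * s.*2%:R + 1) ^+ 2 :> rat.
  by rewrite rmorphXn rmorphD rmorphM.
rewrite hyper_sum_even ?ltnS // rmorphD rmorphM /=.
rewrite [LHS]mulrAC; congr (_ * _); rewrite -mulrA; congr (_ * _).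
rewrite /value_num /value_den !rmorph_prod -big_split /=; apply: eq_bigr => j _.
rewrite !(rmorphM, rmorphD, rmorphB, rmorphN) /= mulfVK //.
have h1 : 4 * j%:R + 3 - 4 * A%:R != 0 :> rat.
  by apply: (eq_neq0 (odd_neq0 (2 * j%:Z + 1 - 2 * A%:Z))); ring.
rewrite !mulf_neq0 //.
  by rewrite -natrM -natrD pnatr_eq0 addn4.
by rewrite -!natrM -!natrD pnatr_eq0 addn4.
Qed.

Lemma Gauss_dvdz_prime (p : nat) (x y : int) : prime p ->
  (p%:Z %| x * y)%Z = (p%:Z %| x)%Z || (p%:Z %| y)%Z.
Proof. by move=> pp; rewrite !dvdzE abszM Euclid_dvdM. Qed.

Lemma ndvdz_prod (p n : nat) (f : nat -> int) : prime p ->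
  (forall j, (j < n)%N -> ~~ (p%:Z %| f j)%Z) -> ~~ (p%:Z %| \prod_(j < n) f j)%Z.
Proof.
move=> pp h; elim: n h => [|n IH] h.
  by rewrite big_ord0 dvdzE /= dvdn1 neq_ltn prime_gt1 // orbT.
rewrite big_ord_recr /= Gauss_dvdz_prime // negb_or h // andbT.
by apply: IH => j jn; apply: h; apply: ltnW.
Qed.

Lemma ndvdz_small (p : nat) (x c d : int) : x - c = d * p%:Z ->
  - p%:Z < c -> c < p%:Z -> c <> 0 -> ~~ (p%:Z %| x)%Z.
Proof.
move=> e h1 h2 c0; apply/negP => dx.
have : (p%:Z %| c)%Z.
  have -> : c = x - d * p%:Z by rewrite -e; ring.
  by rewrite rpredB // dvdz_mull.
by case/dvdz_small => //; lia.
Qed.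

(** * Divisibility by p at the odd squares and of all coefficients *)

Section Roots.
Variables (p M A : nat).
Hypothesis pp : prime p.
Hypothesis p5 : (5 <= p)%N.
Hypothesis pM : p = M.*2.+1.
Hypothesis Ap : (A %% p <= p %/ 4)%N.

Lemma residue_bound : exists2 a : nat, (4 * a < p)%N & exists k : int, A%:Z = a%:Z + k * p%:Z.
Proof.
exists (A %% p)%N; first by move: (leq_trunc_div p 4) Ap pM; lia.
by exists (A %/ p)%N%:Z; rewrite {1}(divn_eq A p) PoszD PoszM addrC.
Qed.

(** After extracting 4, replacing A by its residue a makes every factor a nonzero integer below p in
    absolute value, by 4a < p and 4s < p. *)
Lemma ndvdz_value_den s : (s.*2 <= M)%N -> ~~ (p%:Z %| value_den A s)%Z.
Proof.
move=> sM; have [a ap [k kE]] := residue_bound.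
pose f (j : nat) := (4 * j%:Z + 4) * (4 * j%:Z + 4 + 4 * A%:Z) * (4 * j%:Z + 3 - 4 * A%:Z).
apply: (@ndvdz_prod p s f) => // j js; rewrite /f !Gauss_dvdz_prime // !negb_or.
have pos4 (z c d : int) : z - c = d * p%:Z -> 0 < c < p%:Z -> ~~ (p%:Z %| 4 * z)%Z.
  move=> e /andP[c0 cp]; rewrite Gauss_dvdz_prime // negb_or (@ndvdz_small p 4 4 0) //=.
  - by apply: (ndvdz_small e); lia.
  - by move: p5; lia.
have hb : (4 * j + 4 <= p)%N by move: pM sM js; clear; lia.
rewrite -andbA; apply/and3P; split.
- rewrite (_ : 4 * j%:Z + 4 = 4 * (j%:Z + 1)); last by ring.
  by apply: (pos4 _ (j%:Z + 1) 0); [ring|move: hb; clear; lia].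
- rewrite (_ : 4 * j%:Z + 4 + 4 * A%:Z = 4 * (j%:Z + 1 + A%:Z)); last by ring.
  by apply: (pos4 _ (j%:Z + 1 + a%:Z) k); [rewrite kE; ring|move: hb ap; clear; lia].
- apply: (@ndvdz_small p _ (4 * j%:Z + 3 - 4 * a%:Z) (- 4 * k)); first by rewrite kE; ring.
  + by move: hb ap; clear; lia.
  + by move: hb ap; clear; lia.
  + by clear; lia.
Qed.

Lemma ndvdz_ratio_den0 : ~~ (p%:Z %| \prod_(j < M) ratio_den A 0 j)%Z.
Proof.
have [a ap [k kE]] := residue_bound.
apply: ndvdz_prod => // j js; rewrite /ratio_den subr0 !Gauss_dvdz_prime // !negb_or.
have p16 : ~~ (p%:Z %| 2)%Z by apply: (@ndvdz_small p 2 2 0) => //; move: p5; clear; lia.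
have j1 : ~~ (p%:Z %| j%:Z + 1)%Z.
  by apply: (@ndvdz_small p _ (j%:Z + 1) 0); [ring| | |]; move: pM js; clear; lia.
rewrite (_ : 8 = 2 * (2 * 2)) // (_ : 16 = 2 * (2 * (2 * 2))) //.
rewrite !Gauss_dvdz_prime // !negb_or p16 j1 !andbT /=; apply/andP; split.
- apply: (@ndvdz_small p _ (2 * j%:Z + 1 - 4 * a%:Z) (- 4 * k)); first by rewrite kE; ring.
  + by move: js pM ap; clear; lia.
  + by move: js pM ap; clear; lia.
  + by clear; lia.
- apply: (@ndvdz_small p _ (2 * a%:Z + 1 + j%:Z) (2 * k)); first by rewrite kE; ring.
  + by clear; lia.
  + by move: js pM ap; clear; lia.
  + by clear; lia.
Qed.

(** Some factor equals p = 2M + 1 itself: 4j + 3 - 4s with j = (M-1)/2 + s for M odd; for M even, 4s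
    + 1 if s = M/2, and 4j + 5 + 4s with j = M/2 - 1 - s otherwise. *)
Lemma dvdz_ratio_den (s : nat) : (s.*2 <= M)%N ->
  (p%:Z %| (4 * s%:Z + 1) * \prod_(j < M) ratio_den A ((2 * s.*2%:Z + 1) ^+ 2) j)%Z.
Proof.
move=> sM.
have E j : 16 * (j%:Z + 1) ^+ 2 - (2 * s.*2%:Z + 1) ^+ 2 =
   (4 * j%:Z + 3 - 4 * s%:Z) * (4 * j%:Z + 5 + 4 * s%:Z) :> int.
  by rewrite -mul2n PoszM; ring.
have factor j : (j < M)%N ->
    (p%:Z %| (4 * j%:Z + 3 - 4 * s%:Z) * (4 * j%:Z + 5 + 4 * s%:Z))%Z ->
    (p%:Z %| (4 * s%:Z + 1) * \prod_(j < M) ratio_den A ((2 * s.*2%:Z + 1) ^+ 2) j)%Z.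
  move=> jM d; apply: dvdz_mull; rewrite (bigD1 (Ordinal jM)) //=; apply: dvdz_mulr.
  by rewrite /ratio_den E; apply: dvdz_mull.
have [Mo|Me] := boolP (odd M).
  apply: (factor (M./2 + s)%N); first by move: Mo sM; clear; lia.
  apply: dvdz_mulr; rewrite (_ : 4 * _ + 3 - _ = p%:Z) //.
  by move: Mo pM; clear; lia.
have [sE|sE] := eqVneq s M./2.
  apply: dvdz_mulr; rewrite (_ : 4 * _ + 1 = p%:Z) //.
  by move: Me pM sE; clear; lia.
apply: (factor (M./2 - 1 - s)%N); first by move: sM sE Me; clear; lia.
apply: dvdz_mull; rewrite (_ : 4 * _ + 5 + _ = p%:Z) //.
by move: Me sM sE pM; clear; lia.
Qed.

Lemma dvdz_cleared_sum N : (N <= M)%N -> (p%:Z %| cleared_sum A M ((2 * N%:Z + 1) ^+ 2))%Z.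
Proof.
move=> NM; have [No|Ne] := boolP (odd N).
  have NE : N = (N./2).*2.+1 by rewrite -[LHS]odd_double_half No.
  by rewrite NE cleared_sum_odd ?dvdz0 // -NE.
have NE : N = (N./2).*2 by rewrite -[LHS]odd_double_half (negPf Ne).
rewrite NE; rewrite NE in NM; set s := N./2 in NM *.
have : (p%:Z %| cleared_sum A M ((2 * s.*2%:Z + 1) ^+ 2) * value_den A s)%Z.
  by rewrite cleared_sum_even // mulrAC; apply: dvdz_mulr; apply: dvdz_ratio_den.
by rewrite Gauss_dvdz_prime // (negPf (ndvdz_value_den NM)) orbF.
Qed.

Let polyfac (k j : nat) : {poly int} :=
  if (j < k)%N then
    ((2 * j%:Z + 1) * (4 * j%:Z + 1) * (2 * A%:Z + 1 + 2 * j%:Z) * (4 * j%:Z + 1 - 4 * A%:Z))%:P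
      * (((2 * j%:Z + 1) ^+ 2)%:P - 'X)
  else (8 * (j%:Z + 1) ^+ 2 * (2 * j%:Z + 1 - 4 * A%:Z) * (2 * A%:Z + 1 + j%:Z))%:P
      * ((16 * (j%:Z + 1) ^+ 2)%:P - 'X).

Let cleared_sum_poly : {poly int} :=
  \sum_(k < M.+1) (6 * k%:Z + 1)%:P * \prod_(j < M) polyfac k j.

Lemma horner_cleared_sum w : cleared_sum_poly.[w] = cleared_sum A M w.
Proof.
rewrite /cleared_sum_poly horner_sum; apply: eq_bigr => k _.
rewrite hornerM hornerC horner_prod; congr (_ * _); apply: eq_bigr => j _.
by rewrite /polyfac /ratio_num /ratio_den; case: ifP => _; rewrite !(hornerM, hornerC, hornerD, hornerN, hornerX).
Qed.

Lemma size_cleared_sum_poly : (size cleared_sum_poly <= M.+1)%N.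
Proof.
apply: (leq_trans (size_sum _ _ _)); apply/bigmax_leqP => k _.
rewrite mul_polyC; apply: (leq_trans (size_scale_leq _ _)).
have sz j : (size (polyfac k j) <= 2)%N.
  rewrite /polyfac; case: ifP => _; rewrite mul_polyC;
    apply: (leq_trans (size_scale_leq _ _)); rewrite -opprB size_polyN;
    by rewrite size_XsubC.
suff prod_size n : (size (\prod_(j < n) polyfac k j)%R <= n.+1)%N by [].
elim: n => [|n IH]; first by rewrite big_ord0 size_poly1.
rewrite big_ord_recr /=; apply: (leq_trans (size_polyMleq _ _)).
by have := leq_add IH (sz n); rewrite addn2; case: (_ + _)%N.
Qed.

Lemma intr_Fp_eq0 (x : int) : (x%:~R == 0 :> 'F_p) = (p%:Z %| x)%Z.
Proof. by rewrite intr_Zp_eq0 ?pdiv_id ?prime_gt1. Qed.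

(** Over the field with p elements the polynomial has degree at most M but M + 1 distinct roots, so
    it is zero. *)
Lemma dvdz_coef_cleared_sum_poly i : (p%:Z %| cleared_sum_poly`_i)%Z.
Proof.
pose P := map_poly (intr : int -> 'F_p) cleared_sum_poly.
suff P0 : P = 0.
  by rewrite -intr_Fp_eq0 -(coef_map (intr : int -> 'F_p)) -/P P0 coef0.
apply/eqP; apply: contraT => Pn0.
pose rs := [seq ((2 * N%:Z + 1) ^+ 2)%:~R : 'F_p | N <- iota 0 M.+1].
have rr : all (root P) rs.
  apply/allP => y /mapP[N]; rewrite mem_iota ltnS => /andP[_ NM] ->.
  by rewrite /root horner_map /= horner_cleared_sum intr_Fp_eq0 dvdz_cleared_sum.
have ur : uniq rs.
  rewrite map_inj_in_uniq ?iota_uniq // => N N'; rewrite !mem_iota !ltnS.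
  move=> /andP[_ h1] /andP[_ h2] /eqP; rewrite -subr_eq0 -rmorphB intr_Fp_eq0.
  (* The difference of two points is 4(N-N')(N+N'+1). The last factor is at most 2M + 1 = p, with
     equality only for N = N' = M. *)
  rewrite (_ : _ - _ = 2 * (2 * ((N%:Z - N'%:Z) * (N%:Z + N'%:Z + 1)))); last by ring.
  rewrite !Gauss_dvdz_prime // => /orP[|/orP[|/orP[|]]].
  - by case/dvdz_small; move: p5; clear; lia.
  - by case/dvdz_small; move: p5; clear; lia.
  - by case/dvdz_small; move: p5 pM h1 h2; clear; lia.
  - case/dvdz_small; move: p5 pM h1 h2; clear; lia.
have := max_poly_roots Pn0 rr ur; rewrite size_map size_iota.
by rewrite ltnNge (leq_trans (size_poly _ _)) ?size_cleared_sum_poly.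
Qed.

(** Each nonconstant coefficient contributes a factor p, and its power of p^2 contributes at least
    p^2. *)
Lemma cleared_sum_congr : ((p ^ 3)%:Z %| cleared_sum A M (p%:Z ^+ 2) - cleared_sum A M 0)%Z.
Proof.
rewrite -!horner_cleared_sum !horner_coef.
case: (size cleared_sum_poly) => [|n]; first by rewrite !big_ord0 subrr dvdz0.
rewrite [X in X - _]big_ord_recl [X in _ - X]big_ord_recl /= !expr0.
rewrite [X in _ - (_ + X)]big1 ?addr0 ?[_ * 1 + _]addrC ?addrK; last first.
  by move=> i _; rewrite exprS mul0r mulr0.
apply: rpred_sum => i _; rewrite (exprS (p%:Z ^+ 2)) mulrA dvdz_mulr //.
by rewrite (_ : (p ^ 3)%N%:Z = p%:Z * p%:Z ^+ 2) ?dvdz_mul ?dvdz_coef_cleared_sum_poly.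
Qed.
End Roots.

(** * Rational p-adic integers and the left-hand side *)

Section RatZp.
Variable p : nat.
Hypothesis pp : prime p.

Lemma inv_modP n (x : int) : ~~ (p%:Z %| x)%Z ->
  (inv_mod x (p ^ n)%:Z * x == 1 %[mod (p ^ n)%:Z])%Z.
Proof.
move=> px; rewrite /inv_mod; case: egcdzP => u v e _ /=.
have cop : gcdz x (p ^ n)%:Z = 1.
  apply/eqP; rewrite -[_ == 1]/(coprimez x (p ^ n)%:Z) coprimezE /= coprime_sym.
  by rewrite coprimeXl // prime_coprime.
rewrite eqz_mod_dvd -cop -e; apply/dvdzP; exists (- v); ring.
Qed.

Lemma ndvdz_denq (r : rat) (x y : int) : r * y%:~R = x%:~R -> ~~ (p%:Z %| y)%Z ->
  ~~ (p%:Z %| denq r)%Z /\ numq r * y = x * denq r.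
Proof.
move=> ry py.
have e : numq r * y = x * denq r.
  by apply: (@intr_inj rat); rewrite !rmorphM /= -ry numqE; ring.
split=> //; apply/negP => pd.
have : (p%:Z %| numq r * y)%Z by rewrite e dvdz_mull.
rewrite Gauss_dvdz_prime // (negPf py) orbF => pn.
have : (p %| gcdn `|numq r| `|denq r|)%N by rewrite dvdn_gcd; apply/andP.
have /eqP -> := coprime_num_den r.
by rewrite dvdn1 => /eqP p1; move: pp; rewrite p1.
Qed.

(** Any fraction x/y with p not dividing y may replace the reduced one used by [ratZp]. *)
Lemma ratZpP n (r : rat) (x y : int) : r * y%:~R = x%:~R -> ~~ (p%:Z %| y)%Z ->
  (ratZp p r n * y == x %[mod (p ^ n)%:Z])%Z.
Proof.
move=> ry py; have [pd e] := ndvdz_denq ry py.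
case: n => [|n]; first by rewrite expn0 !modz1.
have q1 : (1 < p ^ n.+1)%N by apply: expn_gt1.
have := inv_modP n.+1 pd; rewrite -!intr_Zp_eq // => /eqP i1; apply/eqP.
apply: (mulIr (intr_Zp_unit pp (ltn0Sn n) pd)).
rewrite /ratZp -!rmorphM -e.
rewrite (_ : _ * _ * y * _ = (inv_mod (denq r) (p ^ n.+1)%:Z * denq r) * (numq r * y)); last by ring.
by rewrite [LHS]rmorphM /= i1 mul1r.
Qed.

Lemma ratZp_padic (r : rat) (x y : int) : r * y%:~R = x%:~R -> ~~ (p%:Z %| y)%Z ->
  padic_seq p (ratZp p r).
Proof.
move=> ry py n; case: n => [|n]; first by rewrite expn0 !modz1.
have h1 := ratZpP n.+1 ry py; have h2 := ratZpP n.+2 ry py.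
have q1 : (1 < p ^ n.+1)%N by apply: expn_gt1.
rewrite -intr_Zp_eq //; apply/eqP.
apply: (mulIr (intr_Zp_unit pp (ltn0Sn n) py)); rewrite -!rmorphM.
apply/eqP; rewrite intr_Zp_eq // (eqP h1) eqz_mod_dvd.
move: h2; rewrite eqz_mod_dvd; apply: dvdz_trans.
by rewrite dvdzE dvdn_exp2l.
Qed.
End RatZp.

Lemma coef_prod k :
  coef k = (6 * k%:R + 1) * \prod_(j < k)
   ((2 * j%:R + 1) ^+ 3 * (4 * j%:R + 1) / (32 * (j%:R + 1) ^+ 4)).
Proof.
have aux n : rfr (7 / 6) n = (6 * n%:R + 1) * rfr (1 / 6) n.
  elim: n => [|n IH]; first by rewrite /rfr !big_ord0; ring.
  move: IH; rewrite /rfr !big_ord_recr /= => ->; by rewrite -natr1; field.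
have nz n : rfr (1 / 6) n != 0.
  apply/prodf_neq0 => j _; apply: (@eq_neq0 _ ((6 * j).+1%:R / 6)); last by field.
  by rewrite mulf_neq0 ?pnatr_eq0 // invr_eq0.
have nz1 n : rfr 1 n != 0.
  by apply/prodf_neq0 => j _; rewrite -[1]/(1%:R) -natrD pnatr_eq0.
have fE n : (n`!)%:R = rfr 1 n.
  elim: n => [|n IH]; first by rewrite /rfr big_ord0.
  by rewrite factS mulnC natrM IH /rfr big_ord_recr /= -natr1 addrC.
rewrite /coef aux fE.
transitivity ((6 * k%:R + 1) * (rfr (1 / 2) k ^+ 3 * rfr (1 / 4) k / rfr 1 k ^+ 4)).
  by have := nz k; have := nz1 k => h1 h2; field; rewrite h1 h2.
congr (_ * _); rewrite /rfr -!prodrXl -!big_split /= -prodf_div.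
apply: eq_bigr => j _.
have j1 : j%:R + 1 != 0 :> rat by rewrite natr1 pnatr_eq0.
by field; split_neq0.
Qed.

(** Division-free, hence usable for integers, unlike [prod_split_ratio]. *)
Lemma prod_split (R : comPzRingType) (M k : nat) (f g : nat -> R) : (k <= M)%N ->
  \prod_(j < M) (if (j < k)%N then f j else g j)
  = \prod_(j < k) f j * \prod_(k <= j < M) g j.
Proof.
move=> kM; rewrite -(big_mkord xpredT (fun j => if (j < k)%N then f j else g j)).
rewrite (big_cat_nat (leq0n k) kM) /=; congr (_ * _).
  rewrite -(big_mkord xpredT f); apply: eq_big_nat => j /andP[_ ->] //.
by apply: eq_big_nat => j /andP[kj _]; rewrite ltnNge kj.
Qed.

Section LeftHandSide.
Variables (p M A : nat) (alpha : nat -> int).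
Hypothesis pp : prime p.
Hypothesis p5 : (5 <= p)%N.
Hypothesis pM : p = M.*2.+1.
Hypothesis Ap : (A %% p <= p %/ 4)%N.
Hypothesis alphaA : (alpha 3 == A%:Z %[mod (p ^ 3)%:Z])%Z.
Local Notation R := 'Z_(p ^ 3).

Lemma ndvdz_two : ~~ (p%:Z %| 2)%Z.
Proof. by apply: (@ndvdz_small p 2 2 0) => //; move: p5; clear; lia. Qed.

Lemma half_Zp : 2 * (ratZp p (1 / 2) 3)%:~R = 1 :> R.
Proof.
have e : 1 / 2 * 2%:~R = 1%:~R :> rat by [].
have := ratZpP pp 3 e ndvdz_two; rewrite -intr_Zp_eq ?expn_gt1 // rmorphM => /eqP h.
by rewrite mulrC; exact: h.
Qed.

Lemma quarter_Zp : 4 * (ratZp p (1 / 4) 3)%:~R = 1 :> R.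
Proof.
have p4 : ~~ (p%:Z %| 4)%Z.
  by apply: (@ndvdz_small p 4 4 0) => //; move: p5; clear; lia.
have e : 1 / 4 * 4%:~R = 1%:~R :> rat by [].
have := ratZpP pp 3 e p4; rewrite -intr_Zp_eq ?expn_gt1 // rmorphM => /eqP h.
by rewrite mulrC; exact: h.
Qed.

Lemma coef_Zp k : (k <= M)%N ->
  (ratZp p (coef k) 3)%:~R * \prod_(j < k) (32 * (j%:R + 1) ^+ 4) =
  (6 * k%:R + 1) * \prod_(j < k) ((2 * j%:R + 1) ^+ 3 * (4 * j%:R + 1)) :> R.
Proof.
move=> kM.
have nd : ~~ (p%:Z %| \prod_(j < k) (32 * (j%:Z + 1) ^+ 4))%Z.
  apply: (@ndvdz_prod p k (fun j => 32 * (j%:Z + 1) ^+ 4)) => // j jk.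
  have j1 : ~~ (p%:Z %| j%:Z + 1)%Z.
    by apply: (@ndvdz_small p _ (j%:Z + 1) 0); [ring| | |]; move: pM kM jk; clear; lia.
  rewrite (_ : 32 * _ = 2 * (2 * (2 * (2 * (2 * ((j%:Z + 1) * ((j%:Z + 1) * ((j%:Z + 1) * (j%:Z + 1))))))))); last by ring.
  by rewrite !Gauss_dvdz_prime // !negb_or !ndvdz_two !j1.
have pr : coef k * (\prod_(j < k) (32 * (j%:Z + 1) ^+ 4))%:~R =
    ((6 * k%:Z + 1) * \prod_(j < k) ((2 * j%:Z + 1) ^+ 3 * (4 * j%:Z + 1)))%:~R :> rat.
  rewrite coef_prod rmorphM !rmorph_prod rmorphD rmorphM /= -mulrA -big_split /=.
  congr (_ * _); apply: eq_bigr => j _.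
  rewrite !(rmorphM, rmorphXn, rmorphD) /=.
  have j1 : j%:R + 1 != 0 :> rat by rewrite natr1 pnatr_eq0.
  by field; split_neq0.
have := ratZpP pp 3 pr nd; move: (ratZp p (coef k) 3) => z.
rewrite -intr_Zp_eq ?expn_gt1 // => /eqP; rewrite !rmorphM /= !rmorph_prod /= => h.
transitivity (z%:~R * \prod_(i < k) (32 * (i%:Z + 1) ^+ 4)%:~R : R).
  by congr (_ * _); apply: eq_bigr => j _; ring.
by rewrite h; congr (_ * _); [ring|apply: eq_bigr => j _; ring].
Qed.

Lemma lhs_term k : (k <= M)%N ->
  (ratZp p (coef k) 3 * rfz (ratZp p (1 / 2) 3 + alpha 3) k * rfz (ratZp p (1 / 4) 3 - alpha 3) k
    * inv_mod (rfz (1 + 2 * alpha 3) k * rfz (ratZp p (1 / 2) 3 - 2 * alpha 3) k) (p ^ 3)%:Z)%:~R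
    * (\prod_(j < k) ratio_den A 0 j)%:~R = ((6 * k%:Z + 1) * \prod_(j < k) ratio_num A 0 j)%:~R :> R.
Proof.
move=> kM; have E0 := coef_Zp kM; have E1 := half_Zp; have E2 := quarter_Zp.
have half_int : (2 * ratZp p (1 / 2) 3 == 1 %[mod (p ^ 3)%:Z])%Z.
  rewrite -intr_Zp_eq ?expn_gt1 // rmorphM; apply/eqP; exact: E1.
have alpha_R : (alpha 3)%:~R = A%:R :> R.
  by apply/eqP; rewrite -[A%:R]/(A%:Z%:~R) intr_Zp_eq ?expn_gt1.
have nd : ~~ (p%:Z %| rfz (1 + 2 * alpha 3) k * rfz (ratZp p (1 / 2) 3 - 2 * alpha 3) k)%Z.
  have [a ap [c cE]] := residue_bound pp p5 pM Ap.
  have [d dE] : exists d : int, alpha 3 = a%:Z + d * p%:Z.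
    move: alphaA; rewrite eqz_mod_dvd => /dvdzP[e eE]; exists (c + e * (p ^ 2)%:Z).
    rewrite -[LHS](subrK A%:Z) eE cE (expnS p 2) PoszM; ring.
  have [u uE] : exists u : int, 2 * ratZp p (1 / 2) 3 = 1 + u * p%:Z.
    move: half_int; rewrite eqz_mod_dvd => /dvdzP[e eE]; exists (e * (p ^ 2)%:Z).
    rewrite -[LHS](subrK 1) eE (expnS p 2) PoszM; ring.
  rewrite Gauss_dvdz_prime // negb_or; apply/andP; split.
    apply: (@ndvdz_prod p k (fun j => 1 + 2 * alpha 3 + j%:R)) => // j jk.
    apply: (@ndvdz_small p _ (2 * a%:Z + 1 + j%:Z) (2 * d)).
    - by rewrite dE natz; ring.
    - by clear; lia.
    - by move: jk kM pM ap; clear; lia.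
    - by clear; lia.
  apply: (@ndvdz_prod p k (fun j => ratZp p (1 / 2) 3 - 2 * alpha 3 + j%:R)) => // j jk.
  (* Doubling makes 1/2 integral: the residue 2j + 1 - 4a is odd and below p in absolute value. *)
  have : ~~ (p%:Z %| 2 * (ratZp p (1 / 2) 3 - 2 * alpha 3 + j%:R))%Z.
    apply: (@ndvdz_small p _ (2 * j%:Z + 1 - 4 * a%:Z) (u - 4 * d)).
    - rewrite (_ : 2 * _ = 2 * ratZp p (1 / 2) 3 - 4 * alpha 3 + 2 * j%:R); last by ring.
      by rewrite uE dE natz; ring.
    - by move: jk kM pM ap; clear; lia.
    - by move: jk kM pM ap; clear; lia.
    - by clear; lia.
  by rewrite Gauss_dvdz_prime // negb_or => /andP[].
have /eqP := inv_modP pp 3 nd; move: (inv_mod _ _) => v /eqP.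
rewrite -intr_Zp_eq ?expn_gt1 // => /eqP.
move: E0 E1 E2; move: (ratZp p (coef k) 3) (ratZp p (1 / 2) 3) (ratZp p (1 / 4) 3) => r h q.
rewrite /rfz !rmorphM /= !rmorph_prod /= => E0 E1 E2 E3.
(* The factors 2^k and 4^k clear the halves and quarters of the Pochhammer symbols. *)
pose two := \prod_(j < k) (2 : R); pose four := \prod_(j < k) (4 : R).
have P1 : \prod_(i < k) (ratio_den A 0 i)%:~R = \prod_(j < k) (32 * (j%:R + 1) ^+ 4) * four
   * two * \prod_(i < k) (1 + 2 * alpha 3 + i%:R)%:~R * \prod_(i < k) (h - 2 * alpha 3 + i%:R)%:~R :> R.
  rewrite -!big_split /=; apply: eq_bigr => j _; rewrite /ratio_den.
  rewrite !(rmorphM, rmorphD, rmorphB, rmorphN, rmorphXn, rmorph1, rmorph_nat) /= alpha_R.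
  transitivity (32 * (j%:R + 1) ^+ 4 * 4 * (1 + 2 * A%:R + j%:R) * (2 * h%:~R - 4 * A%:R + 2 * j%:R) : R).
    by rewrite E1; ring.
  ring.
have P2 : \prod_(i < k) (ratio_num A 0 i)%:~R = \prod_(j < k) ((2 * j%:R + 1) ^+ 3 * (4 * j%:R + 1))
   * (two * \prod_(i < k) (h + alpha 3 + i%:R)%:~R) * (four * \prod_(i < k) (q - alpha 3 + i%:R)%:~R) :> R.
  rewrite -!big_split /=; apply: eq_bigr => j _; rewrite /ratio_num.
  rewrite !(rmorphM, rmorphD, rmorphB, rmorphN, rmorphXn, rmorph1, rmorph_nat) /= alpha_R.
  transitivity ((2 * j%:R + 1) ^+ 3 * (4 * j%:R + 1) * (2 * h%:~R + 2 * A%:R + 2 * j%:R)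
     * (4 * q%:~R - 4 * A%:R + 4 * j%:R) : R).
    by rewrite E1 E2; ring.
  ring.
rewrite P1 P2.
have -> : (6 * k%:Z + 1)%:~R = 6 * k%:R + 1 :> R by ring.
move: E0 E3; set W := \prod_(j < k) (32 * _); set Y := \prod_(j < k) (_ ^+ 3 * _).
set U := \prod_(i < k) (h + alpha 3 + _)%:~R; set V := \prod_(i < k) (q - _ + _)%:~R.
set D1 := \prod_(i < k) (1 + _ + _)%:~R; set D2 := \prod_(i < k) (h - _ + _)%:~R.
move=> E0 E3.
transitivity (r%:~R * W * (v%:~R * (D1 * D2)) * (U * V * two * four)); first by ring.
by rewrite E0 E3; ring.
Qed.

Lemma lhs_cleared_sum : M = (p - 1)./2 ->
  (lhs p alpha 3)%:~R * (\prod_(j < M) ratio_den A 0 j)%:~R = (cleared_sum A M 0)%:~R :> R.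
Proof.
move=> ME; rewrite /lhs /cleared_sum -ME !rmorph_sum mulr_suml; apply: eq_bigr => k _.
have kM : (k <= M)%N by rewrite -ltnS.
rewrite (prod_split (ratio_num A 0) (ratio_den A 0) kM).
have -> : \prod_(j < M) ratio_den A 0 j = \prod_(j < k) ratio_den A 0 j * \prod_(k <= j < M) ratio_den A 0 j.
  by rewrite -(prod_split (ratio_den A 0) (ratio_den A 0) kM); apply: eq_bigr => j _; rewrite if_same.
have := lhs_term kM; set T := (_ * inv_mod _ _); set X := \prod_(j < k) ratio_den A 0 j.
set Y := \prod_(k <= j < M) _ => e.
by rewrite (rmorphM _ X Y) mulrA e -rmorphM mulrA.
Qed.
End LeftHandSide.

(** * Assembly of the congruence *)

Lemma Gammap_gam_mod p (x : nat -> int) (y : int) : prime p -> (2 < p)%N ->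
  padic_seq p x -> (y == x 3%N %[mod (p ^ 3)%:Z])%Z ->
  (Gammap p x 3%N)%:~R = gam_mod p y :> 'Z_(p ^ 2).
Proof.
move=> pp p2 cx xy; apply: (@intr_Zp_le p pp 2 3) => //.
by apply: Gammap_congr => //; rewrite absz_modz_expn // modz_mod.
Qed.

Lemma padic_seqD p x y : padic_seq p x -> padic_seq p y -> padic_seq p (fun n => x n + y n).
Proof.
move=> hx hy n; move: (hx n) (hy n); rewrite !eqz_mod_dvd => h1 h2.
by rewrite opprD addrACA rpredD.
Qed.

Lemma padic_seqN p x : padic_seq p x -> padic_seq p (fun n => - x n).
Proof.
by move=> hx n; move: (hx n); rewrite !eqz_mod_dvd => h; rewrite -opprD rpredN.
Qed.

(** Precision p^2 is enough for the denominators, as the evaluated sum has a factor p. *)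
Lemma ratio_den_congr p A M : prime p ->
  ((p ^ 2)%:Z %| \prod_(j < M) ratio_den A (p%:Z ^+ 2) j - \prod_(j < M) ratio_den A 0 j)%Z.
Proof.
move=> pp; rewrite -eqz_mod_dvd -intr_Zp_eq ?expn_gt1 // !rmorph_prod; apply/eqP.
apply: eq_bigr => j _; apply: (@intr_Zp_le p pp 2 2) => //; rewrite eqz_mod_dvd.
apply/dvdzP; eexists (- (8 * (j%:Z + 1) ^+ 2 * (2 * j%:Z + 1 - 4 * A%:Z) * (2 * A%:Z + 1 + j%:Z))).
rewrite /ratio_den (_ : (p ^ 2)%N%:Z = p%:Z ^+ 2) //; ring.
Qed.

Theorem theorem1p1 (p : nat) (alpha : nat -> int) :
  prime p -> (5 <= p)%N -> padic_seq p alpha ->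
  (alpha 1%N %% p%:Z)%Z <= ((p %/ 4)%N)%:Z ->
  if (p %% 4 == 1)%N then
    pcong p 3 (lhs p alpha)
      (fun n => (-1) ^+ ((p + 3) %/ 4) * p%:Z
         * Gammap p (ratZp p (1 / 2)) n
         * Gammap p (ratZp p (1 / 4)) n ^+ 2
         * Gammap p (fun m => 1 + alpha m) n
         * Gammap p (fun m => ratZp p (3 / 4) m - alpha m) n
         * Gammap p (fun m => ratZp p (1 / 2) m + alpha m) n ^+ 3
         * Gammap p (fun m => ratZp p (1 / 4) m - alpha m) n ^+ 3)
  else pcong p 3 (lhs p alpha) (fun _ => 0).
Proof.
move=> pp p5 ca al.
have p2 : (2 < p)%N by apply: leq_trans p5.
have podd : odd p by case/even_prime: (pp) p2 => [->|].
pose M := (p - 1)./2; have pM : p = M.*2.+1 by move: podd p5; rewrite /M; clear; lia.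
have [A alphaA] := gam_mod_rep pp (alpha 3%N).
have coh k : (0 < k)%N -> (alpha k == alpha 1%N %[mod p%:Z])%Z.
  case: k => // k _; elim: k => // k IH; rewrite -(eqP IH) eqz_mod_dvd.
  have := ca k.+1; rewrite eqz_mod_dvd; apply: dvdz_trans; exact: dvdz_expn.
have Ap : (A %% p <= p %/ 4)%N.
  have e : (alpha 3%N == A%:Z %[mod p%:Z])%Z.
    by move: alphaA; rewrite !eqz_mod_dvd; apply: dvdz_trans; exact: dvdz_expn.
  by rewrite -lez_nat -modz_nat -(eqP e) (eqP (coh 3%N isT)).
have L := lhs_cleared_sum pp p5 pM Ap alphaA (erefl M).
have PC := cleared_sum_congr pp p5 pM Ap.
have uB := intr_Zp_unit pp (isT : (0 < 3)%N) (ndvdz_ratio_den0 pp p5 pM Ap).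
case: ifP => p1; last first.
  have Mo : odd M by move: pM p1 podd; clear; lia.
  rewrite /pcong -intr_Zp_eq ?expn_gt1 //; apply/eqP; apply: (mulIr uB).
  rewrite L mul0r; apply/eqP; rewrite intr_Zp_eq0 ?expn_gt1 //.
  (* For p = 3 mod 4, M is odd, so w = p^2 = (2M+1)^2 is one of the points where the sum
     vanishes. *)
  have ME : M = (M./2).*2.+1 by rewrite -[LHS]odd_double_half Mo.
  move: PC; rewrite (_ : p%:Z = 2 * (M./2).*2.+1%:Z + 1); last by rewrite -ME pM; lia.
  by rewrite cleared_sum_odd -?ME // sub0r rpredN.
have [m mE pE] : exists2 m : nat, m = (p %/ 4)%N & p = (4 * m + 1)%N.
  by exists (p %/ 4)%N; rewrite // {1}(divn_eq p 4) (eqP p1) mulnC.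
have Mm : M = m.*2 by move: pM pE; clear; lia.
have pw : p%:Z = 2 * m.*2%:Z + 1 by move: pE; clear; lia.
(* A natural number representing 1/4 mod p^3. *)
have [q qE] := gam_mod_rep pp (ratZp p (1 / 4) 3%N); rewrite eq_sym in qE.
have n4 : ~~ (p%:Z %| 4)%Z by apply: (@ndvdz_small p 4 4 0) => //; move: p5; clear; lia.
have u4 := intr_Zp_unit pp (isT : (0 < 3)%N) n4.
have q4 : (4 * q%:Z == 1 %[mod (p ^ 3)%:Z])%Z.
  rewrite -(eqP (@ratZpP p pp 3 (1 / 4) 1 4 (erefl _) n4)).
  move: qE; move: (ratZp _ _ _) => z; rewrite !eqz_mod_dvd => qz.
  by rewrite (_ : _ - _ = 4 * (q%:Z - z)) ?dvdz_mull //; ring.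
have quarters (c : int) r : r * 4%:~R = c%:~R -> (c * q%:Z == ratZp p r 3%N %[mod (p ^ 3)%:Z])%Z.
  move=> rE; rewrite -intr_Zp_eq ?expn_gt1 //; apply/eqP; apply: (mulIr u4).
  rewrite -!rmorphM; apply/eqP; rewrite intr_Zp_eq ?expn_gt1 //.
  rewrite (eqP (ratZpP pp 3 rE n4)) eqz_mod_dvd; move: q4; rewrite eqz_mod_dvd => d.
  by rewrite (_ : _ - c = c * (4 * q%:Z - 1)) ?dvdz_mull //; ring.
have cong_alpha (u v : int) : (u == v %[mod (p ^ 3)%:Z])%Z ->
    (u + A%:Z == v + alpha 3%N %[mod (p ^ 3)%:Z])%Z /\ (u - A%:Z == v - alpha 3%N %[mod (p ^ 3)%:Z])%Z.
  move: alphaA; rewrite !eqz_mod_dvd => h1 h2; split.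
    rewrite (_ : _ - _ = (u - v) - (alpha 3%N - A%:Z)); last by ring.
    exact: rpredB.
  rewrite (_ : _ - _ = (u - v) + (alpha 3%N - A%:Z)); last by ring.
  exact: rpredD.
have cr r c : r * 4%:~R = c%:~R -> padic_seq p (ratZp p r).
  by move=> rE; exact: ratZp_padic rE n4.
have e12 : 1 / 2 * 4%:~R = 2%:~R :> rat by [].
have e14 : 1 / 4 * 4%:~R = 1%:~R :> rat by [].
have e34 : 3 / 4 * 4%:~R = 3%:~R :> rat by [].
have G1 := Gammap_gam_mod pp p2 (cr _ _ e12) (quarters _ _ e12).
have G2 := Gammap_gam_mod pp p2 (cr _ _ e14) (quarters _ _ e14).
have G3 := @Gammap_gam_mod p (fun n => 1 + alpha n) (1 + A%:Z) pp p2.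
have G4 := Gammap_gam_mod pp p2 (padic_seqD (cr _ _ e34) (padic_seqN ca)) (cong_alpha _ _ (quarters _ _ e34)).2.
have G5 := Gammap_gam_mod pp p2 (padic_seqD (cr _ _ e12) ca) (cong_alpha _ _ (quarters _ _ e12)).1.
have G6 := Gammap_gam_mod pp p2 (padic_seqD (cr _ _ e14) (padic_seqN ca)) (cong_alpha _ _ (quarters _ _ e14)).2.
have {}G3 := G3 (@padic_seqD p (fun=> 1) alpha (fun n => eqxx _) ca) (cong_alpha 1 1 (eqxx _)).1.
have Am := Ap; rewrite -mE in Am.
have GF := gamma_formula pp pE Am q4.
rewrite (mul1r q%:Z) in G2 G6.
move: GF; rewrite -G1 -G2 -G3 -G4 -G5 -G6.
rewrite /pcong.
set g1 := Gammap p (ratZp p (1 / 2)) 3%N; set g2 := Gammap p (ratZp p (1 / 4)) 3%N.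
set g3 := Gammap p (fun n => 1 + _) 3%N; set g4 := Gammap p (fun n => _ - _) 3%N.
set g5 := Gammap p (fun n => _ + alpha n) 3%N; set g6 := Gammap p (fun n => _ - _) 3%N.
pose K := (-1) ^+ m.+1 * g1 * g2 ^+ 2 * g3 * g4 * g5 ^+ 3 * g6 ^+ 3.
have -> : (-1) ^+ m.+1 * g1%:~R * g2%:~R ^+ 2 * g3%:~R * g4%:~R * g5%:~R ^+ 3 * g6%:~R ^+ 3
  = K%:~R :> 'Z_(p ^ 2).
  by rewrite /K !rmorphM /= !rmorphXn rmorphN1.
rewrite -/(value_num A m) -/(value_den A m) -rmorphM => GF.
have e4 : ((p + 3) %/ 4)%N = m.+1 by move: pE; clear; lia.
suff FIN : (lhs p alpha 3%N == p%:Z * K %[mod (p ^ 3)%:Z])%Z.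
  rewrite (eqP FIN) e4 /K -/g1 -/g2 -/g3 -/g4 -/g5 -/g6; apply/eqP; congr modz.
  by rewrite [(-1) ^+ _ * p%:Z]mulrC -!mulrA.
(* Only the congruence for K mod p^2 is kept; the Gamma values are no longer involved. *)
move: K GF; clear - pp p5 pM Ap L PC uB pE Mm pw => K /eqP.
rewrite intr_Zp_eq ?expn_gt1 // eqz_mod_dvd => dK.
have PS := @cleared_sum_even A M m; rewrite -pw in PS; have {}PS := PS (eq_leq (esym Mm)).
have p4 : 4 * m%:Z + 1 = p%:Z by move: pE; clear; lia.
rewrite p4 in PS.
have uD := intr_Zp_unit pp (isT : (0 < 3)%N) (ndvdz_value_den pp p5 pM Ap (eq_leq (esym Mm))).
(* Both cleared denominators are prime to p, so multiplying by them loses nothing. *)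
rewrite -intr_Zp_eq ?expn_gt1 //; apply/eqP; apply: (mulIr uB); apply: (mulIr uD).
rewrite L -!rmorphM; apply/eqP; rewrite intr_Zp_eq ?expn_gt1 // eqz_mod_dvd.
have BC := ratio_den_congr A M pp.
have p3 : (p ^ 3)%N%:Z = p%:Z * (p ^ 2)%N%:Z by rewrite expnS PoszM.
move: PS PC BC dK; rewrite p3.
move: (\prod_(j < M) ratio_den A 0 j) (\prod_(j < M) ratio_den A (p%:Z ^+ 2) j) => B0 B1.
move: (cleared_sum _ _ _) (cleared_sum _ _ _) (value_num _ _) (value_den _ _) => P0 P1 Nu De PS PC BC dK.
(* With P1 De = p Nu B1, the difference splits into two products of p with a multiple of p^2, and a
   multiple of P1 - P0, which p^3 divides. *)
rewrite (_ : _ - _ = p%:Z * (Nu * (B1 - B0)) + p%:Z * (B0 * (Nu - De * K)) - (P1 - P0) * De); last first.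
  have -> : (P1 - P0) * De = p%:Z * Nu * B1 - P0 * De by rewrite -PS; ring.
  ring.
apply: rpredB; last exact: dvdz_mulr.
by apply: rpredD; apply: dvdz_mul => //; apply: dvdz_mull.
Qed.
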